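(* There is an algorithm that, given any instance of the disjoint-cardinality constrained assortment problem under the two-level nested logit model with $m$ nests and $n$ products per nest ($mn\ge 2$), computes the maximal expected revenue $Z^*$ and an optimal assortment in $O(mn^2\log(mn))$ time.
   Context: Setting. There are $m\ge 1$ nests, each with $n\ge1$ products. Product $j$ of nest $i$ has weight $v_{ij}\ge 0$ and revenue $r_{ij}\ge 0$; the no-purchase option has weight $v_0>0$. Nest $i$ has a dissimilarity parameter $\gamma_i\in(0,1]$ and a capacity $C_i$ (a nonnegative integer). An assortment is $S=(S_1,\ldots,S_m)$ with $S_i\subseteq\{1,\ldots,n\}$; it is feasible if $|S_i|\le C_i$ for all $i$. Put $V_i(S_i)=\sum_{j\in S_i}v_{ij}$ and $R_i(S_i)=\frac{\sum_{j\in S_i}r_{ij}v_{ij}}{V_i(S_i)}$, with the convention $R_i(S_i)=0$ if $V_i(S_i)=0$. The expected revenue of $S$ is $$\Pi(S)=\frac{\sum_{i=1}^m V_i(S_i)^{\gamma_i}R_i(S_i)}{v_0+\sum_{i=1}^m V_i(S_i)^{\gamma_i}}.$$ $Z^*$ is the maximum of $\Pi$ over feasible assortments, and an optimal assortment is a feasible one attaining $Z^*$. Running time counts elementary operations in the real-arithmetic model: each addition, subtraction, multiplication, division, comparison of real numbers, and each evaluation of a power $x^{\gamma_i}$ with $x\ge0$, costs $O(1)$. The constant in $O(\cdot)$ does not depend on the instance. *)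

(* Defs.v *)
From mathcomp Require Import all_boot all_order all_algebra.
From mathcomp Require Import reals exp.

Set Implicit Arguments.
Unset Strict Implicit.
Unset Printing Implicit Defensive.

Import Order.TTheory GRing.Theory Num.Theory.

Local Open Scope ring_scope.

(** * The assortment problem under the two-level nested logit model *)

Record instance (R : realType) (m n : nat) := Instance {
  weight : 'I_m -> 'I_n -> R;
  revenue : 'I_m -> 'I_n -> R;
  weight0 : R;
  dissim : 'I_m -> R;
  capacity : 'I_m -> nat;
  weight_ge0 : forall i j, 0 <= weight i j;
  revenue_ge0 : forall i j, 0 <= revenue i j;
  weight0_gt0 : 0 < weight0;
  dissim_gt0 : forall i, 0 < dissim i;
  dissim_le1 : forall i, dissim i <= 1 }.

Definition assortment (m n : nat) := {ffun 'I_m -> {set 'I_n}}.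

Definition feasible (R : realType) (m n : nat) (I : instance R m n)
    (S : assortment m n) : Prop :=
  forall i, (#|S i| <= capacity I i)%N.

Definition nest_weight (R : realType) (m n : nat) (I : instance R m n)
    (i : 'I_m) (A : {set 'I_n}) : R :=
  \sum_(j in A) weight I i j.

Definition nest_revenue (R : realType) (m n : nat) (I : instance R m n)
    (i : 'I_m) (A : {set 'I_n}) : R :=
  if nest_weight I i A == 0 then 0
  else (\sum_(j in A) revenue I i j * weight I i j) / nest_weight I i A.

(* [powR] satisfies 0 `^ g = 0 for g != 0, so a nest of total weight 0 has
   attraction 0 because [dissim I i] is positive. *)
Definition expected_revenue (R : realType) (m n : nat) (I : instance R m n)
    (S : assortment m n) : R :=
  (\sum_i nest_weight I i (S i) `^ dissim I i * nest_revenue I i (S i))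
  / (weight0 I + \sum_i nest_weight I i (S i) `^ dissim I i).

Definition is_max_revenue (R : realType) (m n : nat) (I : instance R m n)
    (z : R) : Prop :=
  (exists2 S, feasible I S & expected_revenue I S = z) /\
  (forall S, feasible I S -> expected_revenue I S <= z).

Definition optimal (R : realType) (m n : nat) (I : instance R m n)
    (S : assortment m n) : Prop :=
  feasible I S /\ is_max_revenue I (expected_revenue I S).

(** * A uniform real-arithmetic machine

   Programs are finite pieces of syntax that mention neither the instance nor
   its dimensions.  The memory consists of arrays of natural numbers and arrays
   of real numbers, all indexed by [nat]; the name of an array is a literal of
   the program, the position in it is computed.  Every operation, including
   memory accesses and index arithmetic, has cost 1.  There is no conversion
   between indices and reals, and on indices only addition, truncated
   subtraction and comparison are available, so that unit-cost integer
   operations cannot hide work.  The only real constants are 0 and 1. *)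

Inductive nexp : Type :=
| NConst of nat
| NGet of nat & nexp               (* [NGet a e]: entry [e] of nat array [a] *)
| NAdd of nexp & nexp
| NSub of nexp & nexp.

Inductive rexp : Type :=
| RZero
| ROne
| RGet of nat & nexp               (* [RGet a e]: entry [e] of real array [a] *)
| RAdd of rexp & rexp
| RSub of rexp & rexp
| RMul of rexp & rexp
| RDiv of rexp & rexp
| RPow of rexp & nexp.             (* [RPow x e]: x to the power gamma_e *)

Inductive test : Type :=
| NLe of nexp & nexp
| RLe of rexp & rexp
| TNot of test
| TAnd of test & test.

Inductive cmd : Type :=
| Skip
| NSet of nat & nexp & nexp        (* [NSet a e x]: nat array [a] at [e] := x *)
| RSet of nat & nexp & rexp        (* [RSet a e x]: real array [a] at [e] := x *)
| Seq of cmd & cmd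
| If of test & cmd & cmd
| While of test & cmd.

Record memory (R : Type) := Memory {
  nmem : nat -> nat -> nat;        (* array, then position *)
  rmem : nat -> nat -> R }.

Definition update (T : Type) (f : nat -> nat -> T) (a k : nat) (x : T) :
    nat -> nat -> T :=
  fun b l => if (b == a) && (l == k) then x else f b l.

Fixpoint neval (R : Type) (s : memory R) (e : nexp) : nat :=
  match e with
  | NConst k => k
  | NGet a e1 => nmem s a (neval s e1)
  | NAdd e1 e2 => (neval s e1 + neval s e2)%N
  | NSub e1 e2 => (neval s e1 - neval s e2)%N
  end.

(* [g k] is the exponent available as gamma_k.  Powers with any other exponent
   are not primitive.  Division by 0 and powers of negative reals take the
   default values of the library instead of blocking; this adds nothing, since
   a program can test for these cases. *)
Fixpoint reval (R : realType) (g : nat -> R) (s : memory R) (e : rexp) : R :=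
  match e with
  | RZero => 0
  | ROne => 1
  | RGet a e1 => rmem s a (neval s e1)
  | RAdd e1 e2 => reval g s e1 + reval g s e2
  | RSub e1 e2 => reval g s e1 - reval g s e2
  | RMul e1 e2 => reval g s e1 * reval g s e2
  | RDiv e1 e2 => reval g s e1 / reval g s e2
  | RPow e1 e2 => reval g s e1 `^ g (neval s e2)
  end.

Fixpoint teval (R : realType) (g : nat -> R) (s : memory R) (b : test) : bool :=
  match b with
  | NLe e1 e2 => (neval s e1 <= neval s e2)%N
  | RLe e1 e2 => reval g s e1 <= reval g s e2
  | TNot b1 => ~~ teval g s b1
  | TAnd b1 b2 => teval g s b1 && teval g s b2
  end.

Fixpoint ncost (e : nexp) : nat :=
  match e with
  | NConst _ => 1
  | NGet _ e1 => (ncost e1).+1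
  | NAdd e1 e2 | NSub e1 e2 => (ncost e1 + ncost e2).+1
  end.

Fixpoint rcost (e : rexp) : nat :=
  match e with
  | RZero | ROne => 1
  | RGet _ e1 => (ncost e1).+1
  | RAdd e1 e2 | RSub e1 e2 | RMul e1 e2 | RDiv e1 e2 =>
      (rcost e1 + rcost e2).+1
  | RPow e1 e2 => (rcost e1 + ncost e2).+1
  end.

Fixpoint tcost (b : test) : nat :=
  match b with
  | NLe e1 e2 => (ncost e1 + ncost e2).+1
  | RLe e1 e2 => (rcost e1 + rcost e2).+1
  | TNot b1 => (tcost b1).+1
  | TAnd b1 b2 => (tcost b1 + tcost b2).+1
  end.

(* [exec g c s t s']: started in memory [s], the program [c] halts in memory
   [s'] after exactly [t] elementary operations. *)
Inductive exec (R : realType) (g : nat -> R) :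
    cmd -> memory R -> nat -> memory R -> Prop :=
| ExecSkip s : exec g Skip s 1 s
| ExecNSet a e x s :
    exec g (NSet a e x) s (ncost e + ncost x).+1
      (Memory (update (nmem s) a (neval s e) (neval s x)) (rmem s))
| ExecRSet a e x s :
    exec g (RSet a e x) s (ncost e + rcost x).+1
      (Memory (nmem s) (update (rmem s) a (neval s e) (reval g s x)))
| ExecSeq c1 c2 s1 s2 s3 t1 t2 :
    exec g c1 s1 t1 s2 -> exec g c2 s2 t2 s3 ->
    exec g (Seq c1 c2) s1 (t1 + t2) s3
| ExecIf b c1 c2 s s' t :
    exec g (if teval g s b then c1 else c2) s t s' ->
    exec g (If b c1 c2) s (tcost b + t).+1 s'
| ExecWhileF b c s :
    teval g s b = false -> exec g (While b c) s (tcost b).+1 s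
| ExecWhileT b c s1 s2 s3 t1 t2 :
    teval g s1 b = true -> exec g c s1 t1 s2 -> exec g (While b c) s2 t2 s3 ->
    exec g (While b c) s1 (tcost b + t1 + t2).+1 s3.

(** * Input and output conventions *)

(* Exponents available to [RPow]; positions outside the range of nests are
   irrelevant and filled with 1. *)
Definition exponents (R : realType) (m n : nat) (I : instance R m n)
    (k : nat) : R :=
  if insub k is Some i then dissim I i else 1.

(* Two-index data are stored row by row, entry (i, j) at position i * n + j.
   The contents of all other memory cells are arbitrary. *)
Definition input (R : realType) (m n : nat) (I : instance R m n)
    (s : memory R) : Prop :=
  [/\ nmem s 0 0 = m /\ nmem s 1 0 = n,
      forall i : 'I_m, nmem s 2 i = capacity I i,
      rmem s 0 0 = weight0 I /\ (forall i : 'I_m, rmem s 1 i = dissim I i),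
      forall (i : 'I_m) (j : 'I_n), rmem s 2 (i * n + j)%N = weight I i j
    & forall (i : 'I_m) (j : 'I_n), rmem s 3 (i * n + j)%N = revenue I i j].

Definition output_value (R : realType) (s : memory R) : R := rmem s 4 0.

Definition output_assortment (R : realType) (m n : nat) (s : memory R)
    (S : assortment m n) : Prop :=
  forall (i : 'I_m) (j : 'I_n), nmem s 3 (i * n + j)%N = (j \in S i) :> nat.

(* The program [p] computes the maximal expected revenue of [I] and an optimal
   assortment, in exactly [t] elementary operations. *)
Definition solves_in (R : realType) (m n : nat) (I : instance R m n)
    (p : cmd) (s : memory R) (t : nat) : Prop :=
  exists s' : memory R,
    [/\ exec (exponents I) p s t s',
        is_max_revenue I (output_value s')
      & exists2 S : assortment m n, output_assortment s' S & optimal I S].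

(* Main.v *)
Require Import Defs.
From mathcomp Require Import all_boot all_order all_algebra.
From mathcomp Require Import reals sequences exp.
From mathcomp Require Import zify ring lra.

Set Implicit Arguments.
Unset Strict Implicit.
Unset Printing Implicit Defensive.

Import Order.TTheory GRing.Theory Num.Theory.

Local Open Scope ring_scope.

(* Idea.  Fix a nest and place product k at the point (x_k, y_k) = (v_k, r_k v_k).
   If S has V(S)^(g-1) (W(S) - z V(S)) maximal and positive, weighted AM-GM shows that
   every maximizer of W - u V with u = z + (1 - g) (R(S) - z) is as good, so S may be
   taken to be the top items of the lines y_k - u x_k, cut at capacity or at height 0.
   Such a set is "everything not below line j at u" for some j, possibly the zero line
   of a dummy item.  For fixed j these sets only change at the crossings of line j with
   the other lines; sorting the crossings and sweeping them yields all candidates with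
   their V, W and size, O(n^2) per nest in O(n^2 log n) time.

   Each candidate contributes a line a - b z to its nest, and the optimal revenue is the
   root z of v_0 z = sum over nests of the upper envelopes.  The root is found by a
   tournament: pair the lines of every nest, sort the crossings of all pairs, and locate
   the root among them by binary search, a comparison with the root being one evaluation
   of the envelopes.  Then the line that is higher at the root is known in each pair,
   half of the lines disappear, and the costs of the rounds form a geometric series. *)

(** * Costed execution *)

(** The level u of a nest depends on the unknown root and on the unknown maximizer, so the
    candidates for all levels u >= 0 are collected in advance. Storing them as sets would take n^3
    cells per nest; the sweep keeps only V, W and the size, and records with each line a code (j, u)
    from which the set is rebuilt for the m winners. The root couples the nests, so all of them must
    be searched together. Line t of nest i is stored at t * m + i: shifting a position by a multiple
    of m stays in the nest, and a single loop pairs the lines of every nest. Indices can only be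
    added and subtracted. Hence halving is done by counting, which takes linear time and is absorbed
    by the linear work around it, and positions are reached by repeated addition of m or n. Ties
    need care. A total order on the lines, with the index as last criterion, lets every capacity be
    met exactly, and simultaneous crossings are recorded only when all of them have been passed. *)

Fixpoint nwrites (c : cmd) : seq nat :=
  match c with
  | NSet a _ _ => [:: a]
  | Seq c1 c2 | If _ c1 c2 => nwrites c1 ++ nwrites c2
  | While _ c1 => nwrites c1
  | _ => [::]
  end.

Fixpoint rwrites (c : cmd) : seq nat :=
  match c with
  | RSet a _ _ => [:: a]
  | Seq c1 c2 | If _ c1 c2 => rwrites c1 ++ rwrites c2
  | While _ c1 => rwrites c1
  | _ => [::]
  end.

(** The frame is read off the program text, so side conditions [a \notin nwrites c] compute for
    concrete programs. It is tracked per array; the cells of one array are not told apart. *)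
Definition agree (R : Type) (c : cmd) (s s' : memory R) : Prop :=
  (forall a, a \notin nwrites c -> nmem s' a = nmem s a) /\
  (forall a, a \notin rwrites c -> rmem s' a = rmem s a).

Notation nput s a k v := (Memory (update (nmem s) a k v) (rmem s)).
Notation rput s a k v := (Memory (nmem s) (update (rmem s) a k v)).

Lemma update_other (T : Type) (f : nat -> nat -> T) a k x b :
  b != a -> update f a k x b = f b.
Proof. by move=> ab; rewrite /update (negbTE ab). Qed.

Lemma exec_agree (R : realType) (g : nat -> R) c s t s' :
  exec g c s t s' -> agree c s s'.
Proof.
elim=> {c s t s'} //=.
- move=> a e x s; split=> b //=.
  by rewrite inE => ba; rewrite update_other.
- move=> a e x s; split=> b //=.
  by rewrite inE => ba; rewrite update_other.
- move=> c1 c2 s1 s2 s3 _ _ _ [n1 r1] _ [n2 r2].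
  by split=> a /=; rewrite mem_cat negb_or => /andP[a1 a2];
    rewrite ?n2 ?n1 ?r2 ?r1.
- move=> b c1 c2 s s' _ _ [n1 r1].
  by split=> a /=; rewrite mem_cat negb_or => /andP[a1 a2];
    rewrite ?n1 ?r1 //; case: (teval g s b).
- move=> b c s1 s2 s3 _ _ _ _ [n1 r1] _ [n2 r2].
  by split=> a /= aw; rewrite ?n2 ?n1 ?r2 ?r1.
Qed.

(** An upper bound replaces the exact cost of [exec], so that estimates for subprograms can be
    rounded up before they are added. Halting is part of the claim. *)
Definition run (R : realType) (g : nat -> R) (c : cmd) (s : memory R) (T : nat)
    (Q : memory R -> Prop) : Prop :=
  exists t s', [/\ exec g c s t s', (t <= T)%N & Q s'].

Fixpoint cmax (c : cmd) : nat :=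
  match c with
  | Skip => 1
  | NSet a e x => (ncost e + ncost x).+1
  | RSet a e x => (ncost e + rcost x).+1
  | Seq c1 c2 => cmax c1 + cmax c2
  | If b c1 c2 => (tcost b + maxn (cmax c1) (cmax c2)).+1
  | While b c => 0
  end.

Fixpoint wp (R : realType) (g : nat -> R) (c : cmd) (Q : memory R -> Prop)
    (s : memory R) : Prop :=
  match c with
  | Skip => Q s
  | NSet a e x => Q (nput s a (neval s e) (neval s x))
  | RSet a e x => Q (rput s a (neval s e) (reval g s x))
  | Seq c1 c2 => wp g c1 (wp g c2 Q) s
  | If b c1 c2 => if teval g s b then wp g c1 Q s else wp g c2 Q s
  | While _ _ => False
  end.

Section Rules.

Variables (R : realType) (g : nat -> R).
Implicit Types (c : cmd) (s : memory R) (Q : memory R -> Prop).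

Lemma run_imp c s T T' Q Q' :
  run g c s T Q -> (T <= T')%N ->
  (forall s', agree c s s' -> Q s' -> Q' s') -> run g c s T' Q'.
Proof.
move=> [t [s' [ex tT Qs']]] TT' QQ'; exists t, s'; split=> //.
  exact: leq_trans tT TT'.
exact: QQ' (exec_agree ex) Qs'.
Qed.

Lemma run_leq c s T T' Q : (T <= T')%N -> run g c s T Q -> run g c s T' Q.
Proof. by move=> TT' /run_imp; apply. Qed.

Lemma run_wp c s T Q : (cmax c <= T)%N -> wp g c Q s -> run g c s T Q.
Proof.
elim: c s T Q => [|a e x|a e x|c1 IH1 c2 IH2|b c1 IH1 c2 IH2|b c _] s T Q //=.
- by move=> T1 Qs; exists 1%N, s; split=> //; constructor.
- move=> T1 Qs.
  by exists (ncost e + ncost x).+1, (nput s a (neval s e) (neval s x)); split=> //;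
    constructor.
- move=> T1 Qs.
  by exists (ncost e + rcost x).+1, (rput s a (neval s e) (reval g s x)); split=> //;
    constructor.
- move=> T12 /(IH1 _ _ _ (leqnn _)) [t1 [s1 [ex1 t1T]]].
  move=> /(IH2 _ _ _ (leqnn _)) [t2 [s2 [ex2 t2T Qs2]]].
  exists (t1 + t2)%N, s2; split=> //; first exact: ExecSeq ex1 ex2.
  lia.
- move=> Tb; case: ifP => bs.
    move=> /(IH1 _ _ _ (leqnn _)) [t1 [s1 [ex1 t1T Qs1]]].
    exists (tcost b + t1).+1, s1; split=> //; last lia.
    by apply: ExecIf; rewrite bs.
  move=> /(IH2 _ _ _ (leqnn _)) [t1 [s1 [ex1 t1T Qs1]]].
  exists (tcost b + t1).+1, s1; split=> //; last lia.
  by apply: ExecIf; rewrite bs.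
Qed.

Lemma run_seq c1 c2 s T1 T2 Q1 Q :
  run g c1 s T1 Q1 ->
  (forall s1, agree c1 s s1 -> Q1 s1 -> run g c2 s1 T2 Q) ->
  run g (Seq c1 c2) s (T1 + T2) Q.
Proof.
move=> [t1 [s1 [ex1 t1T Qs1]]] /(_ s1 (exec_agree ex1) Qs1).
move=> [t2 [s2 [ex2 t2T Qs2]]].
exists (t1 + t2)%N, s2; split=> //; first exact: ExecSeq ex1 ex2.
exact: leq_add.
Qed.

Lemma run_seqwp c1 c2 s T Q :
  wp g c1 (fun s1 => run g c2 s1 T Q) s ->
  run g (Seq c1 c2) s (cmax c1 + T) Q.
Proof. by move=> W; apply: run_seq (run_wp (leqnn _) W) _. Qed.

(* [f] is the remaining budget of the loop. *)
Lemma run_while b c s0 f0 (P : nat -> memory R -> Prop) :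
  P f0 s0 ->
  (forall f s, P f s -> agree (While b c) s0 s -> teval g s b = true ->
    exists T f', run g c s T (P f') /\ (T + tcost b + f' < f)%N) ->
  run g (While b c) s0 (f0 + (tcost b).+1)
    (fun s => teval g s b = false /\ exists f, P f s).
Proof.
move=> P0 step.
suff H k f s : (f < k)%N -> P f s -> agree (While b c) s0 s ->
    run g (While b c) s (f + (tcost b).+1)
      (fun s => teval g s b = false /\ exists f, P f s).
  by apply: (H f0.+1).
elim: k f s => // k IH f s; rewrite ltnS => fk Ps ag.
case bs: (teval g s b); last first.
  exists (tcost b).+1, s; split; [exact: ExecWhileF|lia|by split=> //; exists f].
have [T [f' [[t [s' [ex tT Ps']]] lef]]] := step _ _ Ps ag bs.
have [nn rr] := exec_agree ex.
have ag' : agree (While b c) s0 s'.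
  by case: ag => na ra; split=> a aw; rewrite ?nn ?rr ?na ?ra.
have [|t2 [s2 [ex2 t2f Q2]]] := IH f' s' _ Ps' ag'; first lia.
exists (tcost b + t + t2).+1, s2; split=> //; first exact: ExecWhileT ex ex2.
lia.
Qed.

Definition For (x : nat) (e : nexp) (c : cmd) : cmd :=
  Seq (NSet x (NConst 0) (NConst 0))
    (While (NLe (NAdd (NGet x (NConst 0)) (NConst 1)) e)
      (Seq c (NSet x (NConst 0) (NAdd (NGet x (NConst 0)) (NConst 1))))).

(** Besides its body an iteration costs at most 20: the test at most 13, by [ncost e <= 8], the
    increment 6, the loop step 1. The bound [e] is evaluated afresh by each test, hence the demand
    that it equal [N] in the states reached. *)
Lemma run_for x e c s0 N T (P : nat -> memory R -> Prop) :
  (ncost e <= 8)%N -> x \notin nwrites c ->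
  P 0%N (nput s0 x 0%N 0%N) ->
  (forall k s, (k <= N)%N -> nmem s x 0%N = k -> P k s ->
    agree (For x e c) s0 s -> neval s e = N) ->
  (forall k s, (k < N)%N -> nmem s x 0%N = k -> P k s ->
    agree (For x e c) s0 s ->
    run g c s T (fun s' => P k.+1 (nput s' x 0%N k.+1))) ->
  run g (For x e c) s0 (N * (T + 20) + 20) (P N).
Proof.
move=> e8 xc P0 eN step; rewrite /For.
have -> : (N * (T + 20) + 20 = 3 + (N * (T + 20) + 17))%N by lia.
apply: run_seqwp => /=.
set s1 := nput _ _ _ _.
set b := NLe _ _; set c' := Seq c _.
have tb : (tcost b <= 13)%N by rewrite /b /=; lia.
have agf s : agree (While b c') s1 s -> agree (For x e c) s0 s.
  move=> [ha ra]; split=> a aw.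
    rewrite ha; last by move: aw; rewrite /= !inE !mem_cat !negb_or => /andP[].
    by rewrite /s1 /= update_other //; move: aw; rewrite /= inE negb_or => /andP[].
  by rewrite ra //; move: aw; rewrite /= cats0.
pose P' f s := exists k, [/\ (k <= N)%N, nmem s x 0%N = k, P k s
                          & f = ((N - k) * (T + 20))%N].
have: run g (While b c') s1 (N * (T + 20) + (tcost b).+1)
        (fun s => teval g s b = false /\ exists f, P' f s).
  apply: run_while; first by exists 0%N; rewrite subn0; split=> //; rewrite /s1 /= /update !eqxx.
  move=> f s [k [kN sk Pk ->]] ag /=.
  rewrite (eN k s) ?sk ?addn1 //; last exact: agf.
  move=> kN'.
  exists (T + 6)%N, ((N - k.+1) * (T + 20))%N; split; last first.
    have -> : (N - k = (N - k.+1).+1)%N by lia.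
    by rewrite mulSn; move: tb; rewrite /b /=; lia.
  apply: (run_seq (step k s kN' sk Pk (agf _ ag))) => s' [as' _] Ps'.
  apply: run_wp => //=.
  by rewrite as' // sk addn1; exists k.+1; split=> //; rewrite /= /update !eqxx.
move/run_imp; apply; first lia.
move=> s' ag [bf [f [k [kN sk Pk _]]]].
move: bf => /=; rewrite (eN k s') ?sk ?addn1 //; last exact: agf.
move/negbT; rewrite -leqNgt => Nk.
by have -> : N = k by lia.
Qed.

End Rules.

Notation "c1 ;; c2" := (Seq c1 c2) (at level 90, right associativity).
Notation nv a := (NGet a (NConst 0)).
Notation rv a := (RGet a (NConst 0)).
Notation nset a e := (NSet a (NConst 0) e).
Notation rset a e := (RSet a (NConst 0) e).
Notation NLt e1 e2 := (NLe (NAdd e1 (NConst 1)) e2).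

(** * Bottom-up merge sort *)

(* Names of memory cells: [a] for arrays of indices, [x] for index variables, kept at
   position 0 of an array of their own, [r] for real arrays and real variables. *)
Notation aPERM := 4%N (only parsing).
Notation aTMP := 5%N (only parsing).
Notation xNUM := 10%N (only parsing).
Notation xW := 11%N (only parsing).
Notation xLO := 12%N (only parsing).
Notation xMID := 13%N (only parsing).
Notation xHI := 14%N (only parsing).
Notation xPI := 15%N (only parsing).
Notation xPJ := 16%N (only parsing).
Notation xPO := 17%N (only parsing).
Notation xSK := 18%N (only parsing).
Notation rKEY := 5%N (only parsing).

Definition sub (T : Type) (f : nat -> T) (lo hi : nat) : seq T :=
  [seq f k | k <- iota lo (hi - lo)].

Lemma size_sub (T : Type) (f : nat -> T) lo hi : size (sub f lo hi) = (hi - lo)%N.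
Proof. by rewrite size_map size_iota. Qed.

Lemma sub_nil (T : Type) (f : nat -> T) lo hi : (hi <= lo)%N -> sub f lo hi = [::].
Proof. by rewrite -subn_eq0 /sub => /eqP ->. Qed.

Lemma sub_cons (T : Type) (f : nat -> T) lo hi :
  (lo < hi)%N -> sub f lo hi = f lo :: sub f lo.+1 hi.
Proof. by move=> lh; rewrite /sub -(subnSK lh). Qed.

Lemma sub_cat (T : Type) (f : nat -> T) lo mid hi :
  (lo <= mid)%N -> (mid <= hi)%N -> sub f lo hi = sub f lo mid ++ sub f mid hi.
Proof.
move=> lm mh; rewrite /sub -map_cat.
have -> : (hi - lo = (mid - lo) + (hi - mid))%N by lia.
by rewrite iotaD subnKC.
Qed.

Lemma sub_rcons (T : Type) (f : nat -> T) lo hi :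
  (lo <= hi)%N -> sub f lo hi.+1 = rcons (sub f lo hi) (f hi).
Proof.
move=> lh; rewrite (@sub_cat _ _ lo hi) // -cats1.
by congr (_ ++ _); rewrite sub_cons // sub_nil.
Qed.

Lemma eq_sub (T : Type) (f f' : nat -> T) lo hi :
  (forall k, (lo <= k < hi)%N -> f k = f' k) -> sub f lo hi = sub f' lo hi.
Proof.
move=> ff'; apply/eq_in_map => k; rewrite mem_iota => /andP[lk kh].
by apply: ff'; rewrite lk; move: kh; lia.
Qed.

Lemma nth_sub (T : Type) (x0 : T) (f : nat -> T) N k :
  (k < N)%N -> nth x0 (sub f 0 N) k = f k.
Proof.
by move=> kN; rewrite (nth_map 0%N) ?size_iota ?subn0 // nth_iota.
Qed.

(* A pass of the merge sort turns [runs w] into [runs (w + w)]. *)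
Inductive runs (T : Type) (le : rel T) (w : nat) : seq T -> Prop :=
| RunsNil : runs le w [::]
| RunsCat r s : sorted le r -> (size r <= w)%N -> (size r = w \/ s = [::]) ->
    runs le w s -> runs le w (r ++ s).

Lemma runs_take_drop (T : Type) (le : rel T) w s :
  runs le w s -> sorted le (take w s) /\ runs le w (drop w s).
Proof.
case=> [|r s' sr rw rs rr]; first by split=> //; constructor.
case: rs => [rE|->]; first by rewrite take_size_cat // drop_size_cat.
by rewrite cats0 take_oversize // drop_oversize //; split=> //; exact: RunsNil.
Qed.

Lemma runs_sorted (T : Type) (le : rel T) w s :
  runs le w s -> (size s <= w)%N -> sorted le s.
Proof. by move=> /runs_take_drop[+ _] sw; rewrite take_oversize. Qed.

Lemma runs1 (T : Type) (le : rel T) s : runs le 1 s.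
Proof.
elim: s => [|x s IH]; first exact: RunsNil.
by apply: (@RunsCat T le 1 [:: x] s) => //; left.
Qed.

Definition key_le (R : realType) (key : nat -> R) : rel nat :=
  fun a b => key a <= key b.

Lemma key_le_total (R : realType) (key : nat -> R) : total (key_le key).
Proof. by move=> a b; exact: le_total. Qed.

Definition merge_body : cmd :=
  (If (TAnd (NLt (nv xPI) (nv xMID))
        (TNot (TAnd (NLt (nv xPJ) (nv xHI))
           (TNot (RLe (RGet rKEY (NGet aPERM (nv xPI)))
                      (RGet rKEY (NGet aPERM (nv xPJ))))))))
    (NSet aTMP (nv xPO) (NGet aPERM (nv xPI)) ;;
     nset xPI (NAdd (nv xPI) (NConst 1)))
    (NSet aTMP (nv xPO) (NGet aPERM (nv xPJ)) ;;
     nset xPJ (NAdd (nv xPJ) (NConst 1)))) ;;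
  nset xPO (NAdd (nv xPO) (NConst 1)).

Definition merge_loop : cmd := While (NLt (nv xPO) (nv xHI)) merge_body.

(** With truncated subtraction, a - (a - N) is the minimum of a and N; this cuts the last blocks off
    at the end of the array. *)
Definition block_body : cmd :=
  nset xMID (NSub (NAdd (nv xLO) (nv xW)) (NSub (NAdd (nv xLO) (nv xW)) (nv xNUM))) ;;
  nset xHI (NSub (NAdd (nv xMID) (nv xW)) (NSub (NAdd (nv xMID) (nv xW)) (nv xNUM))) ;;
  nset xPI (nv xLO) ;;
  nset xPJ (nv xMID) ;;
  nset xPO (nv xLO) ;;
  merge_loop ;;
  nset xLO (nv xHI).

Definition block_loop : cmd := While (NLt (nv xLO) (nv xNUM)) block_body.

Definition copy_loop : cmd :=
  For xSK (nv xNUM) (NSet aPERM (nv xSK) (NGet aTMP (nv xSK))).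

Definition width_body : cmd :=
  nset xLO (NConst 0) ;;
  block_loop ;;
  copy_loop ;;
  nset xW (NAdd (nv xW) (nv xW)).

Definition sort_cmd : cmd :=
  nset xW (NConst 1) ;;
  While (NLt (nv xW) (nv xNUM)) width_body.

Section Sort.

Variables (R : realType) (g : nat -> R).
Implicit Types s : memory R.

(** Invariant: what has been written, followed by the library's [merge] of the two remainders, is
    the merge of the whole. The cells below [lo] hold the blocks already merged in this pass and
    must survive. *)
Lemma merge_loop_spec s lo mid hi :
  nmem s xPI 0%N = lo -> nmem s xMID 0%N = mid -> nmem s xPJ 0%N = mid ->
  nmem s xHI 0%N = hi -> nmem s xPO 0%N = lo -> (lo <= mid)%N -> (mid <= hi)%N ->
  run g merge_loop s ((hi - lo) * 100 + 20) (fun s' =>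
    sub (nmem s' aTMP) lo hi =
      merge (key_le (rmem s rKEY)) (sub (nmem s aPERM) lo mid)
        (sub (nmem s aPERM) mid hi) /\
    forall l, (l < lo)%N -> nmem s' aTMP l = nmem s aTMP l).
Proof.
move=> sPI sMID sPJ sHI sPO lm mh.
set le := key_le _.
pose P f s' := exists i j o,
  [/\ nmem s' xPI 0%N = i, nmem s' xPJ 0%N = j, nmem s' xPO 0%N = o,
      [/\ (lo <= i)%N, (i <= mid)%N, (mid <= j)%N, (j <= hi)%N & (o + mid = i + j)%N]
    & [/\ f = ((hi - o) * 100)%N,
          sub (nmem s' aTMP) lo o ++ merge le (sub (nmem s aPERM) i mid)
            (sub (nmem s aPERM) j hi) =
          merge le (sub (nmem s aPERM) lo mid) (sub (nmem s aPERM) mid hi)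
        & forall l, (l < lo)%N -> nmem s' aTMP l = nmem s aTMP l]].
have := @run_while R g (NLt (nv xPO) (nv xHI)) merge_body s ((hi - lo) * 100)%N P.
move=> /(_ _ _)/run_imp; apply; [| |by rewrite leq_add2l|].
- by exists lo, mid, lo; split=> //; split=> //; rewrite (sub_nil _ (leqnn lo)).
- move=> f s' [i [j [o [s'PI s'PJ s'PO [loi im mj jh oij] [-> Eq Old]]]]] [an ar].
  have aK : rmem s' rKEY = rmem s rKEY by rewrite ar.
  have aP : nmem s' aPERM = nmem s aPERM by rewrite an.
  have aM : nmem s' xMID 0%N = mid by rewrite an.
  have aH : nmem s' xHI 0%N = hi by rewrite an.
  rewrite /= s'PO aH addn1 => oh.
  exists 60%N, ((hi - o.+1) * 100)%N; split; last lia.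
  apply: run_wp => //=.
  rewrite s'PI s'PJ s'PO aM aH aK aP !addn1.
  case: ifPn => [/andP[im' br]|br] /=.
    rewrite /update /= ?aP ?s'PI ?s'PO ?addn1.
    exists i.+1, j, o.+1; split=> //; first (by split=> //; lia); split=> //.
    + rewrite -Eq sub_rcons; last lia.
      rewrite /= eqxx /= cat_rcons (sub_cons _ im').
      rewrite (@eq_sub _ _ (nmem s' aTMP)); last first.
        by move=> k kk /=; case: eqP => //; lia.
      congr (_ ++ _); move: br; case: (ltnP j hi) => [jh' /=|hj _].
        by rewrite (sub_cons _ jh') /= /le /key_le negbK => ->.
      by rewrite (sub_nil _ hj) /=; case: (sub _ i.+1 mid).
    + by move=> l ll /=; case: eqP => [|_]; [lia|exact: Old].
  rewrite /update /= ?aP ?s'PJ ?s'PO ?addn1.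
  have jh' : (j < hi)%N.
    by move: br; case: (ltnP i mid) => /= [_|]; [rewrite negbK => /andP[] //|lia].
  exists i, j.+1, o.+1; split=> //; first (by split=> //; lia); split=> //.
  + rewrite -Eq sub_rcons; last lia.
    rewrite /= eqxx /= cat_rcons (sub_cons _ jh').
    rewrite (@eq_sub _ _ (nmem s' aTMP)); last first.
      by move=> k kk /=; case: eqP => //; lia.
    congr (_ ++ _); move: br; case: (ltnP i mid) => [im'|mi _] /=.
      by rewrite jh' (sub_cons _ im') /= negbK /le /key_le => /negbTE ->.
    by rewrite (sub_nil _ mi).
  + by move=> l ll /=; case: eqP => [|_]; [lia|exact: Old].
- move=> s' ag [bf [f [i [j [o [_ _ s'PO [loi im mj jh oij] [_ Eq Old]]]]]]].
  move: bf; rewrite /= s'PO addn1 ag.1 // sHI => /negbT; rewrite -leqNgt => ho.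
  split=> //; rewrite -Eq.
  have [-> [-> ->]] : o = hi /\ (i = mid /\ j = hi) by lia.
  by rewrite !(sub_nil _ (leqnn _)) cats0.
Qed.

Lemma block_loop_spec s N w :
  nmem s xLO 0%N = 0%N -> nmem s xNUM 0%N = N -> nmem s xW 0%N = w -> (0 < w)%N ->
  runs (key_le (rmem s rKEY)) w (sub (nmem s aPERM) 0 N) ->
  run g block_loop s (N * 300 + 20) (fun s' =>
    runs (key_le (rmem s rKEY)) (w + w) (sub (nmem s' aTMP) 0 N) /\
    perm_eq (sub (nmem s' aTMP) 0 N) (sub (nmem s aPERM) 0 N)).
Proof.
move=> sLO sNUM sW w0.
set le := key_le _; set p := nmem s aPERM => r0.
(* [runs] grows at the front while the loop appends at the end. The finished part is therefore
   described by what may follow it: any [Y] of the missing length that consists of runs of length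
   [w + w]. *)
pose P f s' := exists lo,
  [/\ nmem s' xLO 0%N = lo, (lo <= N)%N, f = ((N - lo) * 300)%N,
      runs le w (sub p lo N)
    & perm_eq (sub (nmem s' aTMP) 0 lo ++ sub p lo N) (sub p 0 N) /\
      forall Y, size Y = (N - lo)%N -> runs le (w + w) Y ->
        runs le (w + w) (sub (nmem s' aTMP) 0 lo ++ Y)].
have := @run_while R g (NLt (nv xLO) (nv xNUM)) block_body s (N * 300)%N P.
move=> /(_ _ _)/run_imp; apply; [| |by rewrite leq_add2l|].
- by exists 0%N; rewrite subn0; split=> //; split.
- move=> f s' [lo [s'LO loN -> rlo [plo Ylo]]] ag.
  have aK : rmem s' rKEY = rmem s rKEY by rewrite ag.2.
  have aP : nmem s' aPERM = p by rewrite ag.1.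
  have aN : nmem s' xNUM 0%N = N by rewrite ag.1.
  have aW : nmem s' xW 0%N = w by rewrite ag.1.
  rewrite /= s'LO aN addn1 => loN'.
  set mid := minn (lo + w) N; set hi := minn (mid + w) N.
  have lm : (lo <= mid)%N by rewrite /mid; lia.
  have mh : (mid <= hi)%N by rewrite /hi /mid; lia.
  have lh : (lo < hi)%N by rewrite /hi /mid; lia.
  have hN : (hi <= N)%N by rewrite /hi; lia.
  have tdl : take w (sub p lo N) = sub p lo mid /\ drop w (sub p lo N) = sub p mid N.
    rewrite (@sub_cat _ _ lo mid) //; last by rewrite /mid; lia.
    case: (leqP (lo + w) N) => h.
      have sw : size (sub p lo mid) = w by rewrite size_sub /mid; lia.
      by rewrite take_size_cat // drop_size_cat.
    have -> : mid = N by rewrite /mid; lia.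
    rewrite (@sub_nil _ _ N N) // cats0.
    by rewrite take_oversize ?drop_oversize // size_sub; lia.
  have tdm : take w (sub p mid N) = sub p mid hi /\ drop w (sub p mid N) = sub p hi N.
    rewrite (@sub_cat _ _ mid hi) //.
    case: (leqP (mid + w) N) => h.
      have sw : size (sub p mid hi) = w by rewrite size_sub /hi; lia.
      by rewrite take_size_cat // drop_size_cat.
    have -> : hi = N by rewrite /hi; lia.
    rewrite (@sub_nil _ _ N N) // cats0.
    by rewrite take_oversize ?drop_oversize // size_sub; lia.
  have := runs_take_drop rlo; rewrite tdl.1 tdl.2 => -[sl rm].
  have := runs_take_drop rm; rewrite tdm.1 tdm.2 => -[sm rh].
  exists ((hi - lo) * 100 + 180)%N, ((N - hi) * 300)%N; split; last first.
    by rewrite /=; lia.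
  rewrite /block_body.
  apply: (@run_leq _ _ _ _ (16 + (16 + (4 + (4 + (4 + ((hi - lo) * 100 + 20 + 10))))))).
    by lia.
  do 5!apply: run_seqwp => /=; rewrite /update /= s'LO aW aN.
  have mE : (lo + w - (lo + w - N))%N = mid by rewrite /mid; lia.
  rewrite !mE.
  have hE : (mid + w - (mid + w - N))%N = hi by rewrite /hi; lia.
  rewrite !hE.
  apply: run_seq; first by apply: (@merge_loop_spec _ lo mid hi).
  move=> s2 a2 /= [Eq Old]; apply: run_wp => //=.
  rewrite /update /= a2.1 // /=.
  have Tlo : sub (nmem s2 aTMP) 0 lo = sub (nmem s' aTMP) 0 lo.
    by apply: eq_sub => k /andP[_]; exact: Old.
  move: Eq; rewrite aK aP -/le => Eq.
  exists hi; split=> //=; split.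
    rewrite (@sub_cat _ _ 0 lo hi) //; last exact: ltnW.
    rewrite Tlo Eq -catA; apply: perm_trans plo; rewrite perm_cat2l.
    rewrite (@sub_cat _ _ lo mid N) //; last exact: leq_trans hN.
    rewrite (@sub_cat _ _ mid hi N) // catA perm_cat2r.
    by rewrite perm_merge.
  move=> Y sY rY; rewrite (@sub_cat _ _ 0 lo hi) //; last exact: ltnW.
  rewrite Tlo Eq -catA; apply: Ylo.
    by rewrite size_cat size_merge size_cat !size_sub sY; lia.
  have sz : size (merge le (sub p lo mid) (sub p mid hi)) = (hi - lo)%N.
    by rewrite size_merge size_cat !size_sub; lia.
  apply: RunsCat => //.
  + by apply: merge_sorted => //; exact: key_le_total.
  + by rewrite sz /hi /mid; lia.
  (* A merged block shorter than [w + w] was cut off at [N], so nothing follows it. *)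
  + rewrite sz; case: (ltnP (hi - lo) (w + w)) => h; last first.
      by left; move: h; rewrite /hi /mid; lia.
    by right; apply: size0nil; rewrite sY; move: h; rewrite /hi /mid; lia.
- move=> s' ag [bf [f [lo [s'LO loN _ rlo [plo Ylo]]]]].
  move: bf; rewrite /= s'LO addn1 ag.1 // sNUM => /negbT; rewrite -leqNgt => Nlo.
  have loE : lo = N by lia.
  subst lo; move: plo (Ylo [::]); rewrite loE (sub_nil _ (leqnn _)) !cats0 subnn => -> Yl.
  by split=> //; apply: Yl => //; exact: RunsNil.
Qed.

Lemma copy_loop_spec s N :
  nmem s xNUM 0%N = N ->
  run g copy_loop s (N * 40 + 20) (fun s' =>
    sub (nmem s' aPERM) 0 N = sub (nmem s aTMP) 0 N).
Proof.
move=> sN.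
apply: (@run_leq _ _ _ _ (N * (20 + 20) + 20)) => //.
apply: (@run_for _ _ _ _ _ _ N 20 (fun k s' => 
  sub (nmem s' aPERM) 0 k = sub (nmem s aTMP) 0 k)) => //.
- by move=> k s' kN sk Pk ag /=; rewrite ag.1.
move=> k s' kN sk Pk ag; apply: run_wp => //=.
rewrite /update /= !sub_rcons // sk eqxx ag.1 //; congr (rcons _ _).
rewrite -Pk; apply: eq_sub => l /andP[_ lk].
by case: eqP => // E; lia.
Qed.

(** [e] plays the role of the binary logarithm: the invariant [N <= w * 2 ^ e'] says that [e'] more
    doublings suffice, and each pass is linear. *)
Lemma sort_spec s N e :
  nmem s xNUM 0%N = N -> (N <= 2 ^ e)%N ->
  run g sort_cmd s ((N + 1) * (e + 1) * 500) (fun s' =>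
    sorted (key_le (rmem s rKEY)) (sub (nmem s' aPERM) 0 N) /\
    perm_eq (sub (nmem s' aPERM) 0 N) (sub (nmem s aPERM) 0 N)).
Proof.
move=> sN Ne.
set le := key_le _.
pose P f s' := exists w e',
  [/\ nmem s' xW 0%N = w, (0 < w)%N, (N <= w * 2 ^ e')%N,
      runs le w (sub (nmem s' aPERM) 0 N) /\
      perm_eq (sub (nmem s' aPERM) 0 N) (sub (nmem s aPERM) 0 N)
    & f = (e' * ((N + 1) * 400))%N].
apply: (@run_imp _ _ _ _ (cmax (nset xW (NConst 1)) +
   (e * ((N + 1) * 400) + (tcost (NLt (nv xW) (nv xNUM))).+1)) _
   (fun s' => teval g s' (NLt (nv xW) (nv xNUM)) = false /\
      exists f, P f s')); last 2 first.
- by rewrite /=; nia.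
- move=> s' ag [bf [f [w [e' [sW w0 _ [rw pw] _]]]]]; split=> //.
  move: bf; rewrite /= sW addn1 ag.1 // sN => /negbT; rewrite -leqNgt => Nw.
  by apply: runs_sorted rw _; rewrite size_sub subn0.
apply: run_seqwp => /=; apply: run_while.
  by exists 1%N, e; rewrite mul1n; split=> //; split=> //; exact: runs1.
move=> f s' [w [e' [sW w0 Nw [rw pw] ->]]] ag.
have aN : nmem s' xNUM 0%N = N by rewrite ag.1.
have aK : rmem s' rKEY = rmem s rKEY by rewrite ag.2.
rewrite /= sW aN addn1 => wN.
case: e' Nw => [|e' Nw]; first by rewrite muln1; lia.
exists (6 + ((N * 300 + 20) + ((N * 40 + 20) + 20)))%N, (e' * ((N + 1) * 400))%N.
split; last by rewrite mulSn; lia.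
rewrite /width_body.
apply: run_seq.
  by apply: (@run_wp _ _ _ _ _ (eq (nput s' xLO 0%N 0%N))).
move=> _ _ <-; apply: run_seq.
  by apply: (@block_loop_spec _ N w) => //=; rewrite aK.
move=> s2 a2 /= [r2 p2]; apply: run_seq.
  by apply: copy_loop_spec; rewrite a2.1.
move=> s3 a3 E3; apply: run_wp => //=.
rewrite /update /= a3.1 // a2.1 // /update /= sW.
exists (w + w)%N, e'; split=> //=.
- by rewrite addn_gt0 w0.
- by rewrite addnn -muln2 -mulnA -expnS.
- rewrite /= E3; split; first by move: r2; rewrite /update /= aK.
  exact: perm_trans p2 pw.
Qed.

End Sort.

(** * Candidate sets of a nest *)

Section Exchange.

Variables (R : realType) (T : finType) (h : T -> R).

(** After cancelling the common part, entries of [A] outside [S] are at most [th] and entries of [S]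
    outside [A] are at least [th]. Either there are at least as many of the latter, or [th = 0] and
    their number does not matter. The two cases are the cut at capacity and the cut at height 0. *)
Lemma threshold_sum_max (th : R) (A S : {set T}) :
  0 <= th -> (forall k, th < h k -> k \in S) -> (forall k, k \in S -> th <= h k) ->
  th = 0 \/ (#|A| <= #|S|)%N -> \sum_(k in A) h k <= \sum_(k in S) h k.
Proof.
move=> th0 hS Sh card.
rewrite [leLHS](big_setID S) [leRHS](big_setID A) /= setIC lerD2l.
apply: (@le_trans _ _ (th *+ #|A :\: S|)).
  rewrite -sumr_const; apply: ler_sum => k; rewrite inE => /andP[kS _].
  by rewrite leNgt; apply: contra kS; exact: hS.
apply: (@le_trans _ _ (th *+ #|S :\: A|)); last first.
  rewrite -sumr_const; apply: ler_sum => k; rewrite inE => /andP[_ kS].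
  exact: Sh.
case: card => [->|card]; first by rewrite !mul0rn.
apply: ler_wpMn2l => //.
have := cardsID S A; have := cardsID A S; rewrite setIC; move: card; lia.
Qed.

End Exchange.

Section Candidates.

Variables (R : realType) (n : nat) (x y : nat -> R).

(* The line of item [k] at level [u] is [y k - u * x k]; the index [n] is a
   dummy item with [x n = y n = 0].  The clamped crossing point of the lines of
   [j] and [k], the dummy getting the sentinel 0. *)
Definition key (j k : nat) : R :=
  if (k < n)%N then Num.max 0 ((y k - y j) / (x k - x j)) else 0.

Definition above_tie (j k : nat) : bool :=
  (y j < y k) || ((y k == y j) && (j <= k)%N).

(* Is the line of [k] above the line of [j] before, resp. after, the crossing? *)
Definition pre (j k : nat) : bool :=
  (k < n)%N && (if x k == x j then above_tie j k else x j < x k).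

Definition post (j k : nat) : bool :=
  (k < n)%N && (if x k == x j then above_tie j k else x k < x j).

(** A crossing counts as passed from its own level on, so the sets are constant on half-open
    intervals that contain their left ends. *)
Definition cand (j : nat) (u : R) (k : nat) : bool :=
  if key j k <= u then post j k else pre j k.

Definition cand_set (j : nat) (u : R) : {set 'I_n} := [set k : 'I_n | cand j u k].

(* The order of the lines just to the right of [u]. *)
Definition lex (u : R) (j k : nat) : bool :=
  let h l := y l - u * x l in
  (h j < h k) || ((h k == h j) && ((x k < x j) || ((x k == x j) && (j <= k)%N))).

(** For [u >= 0] clamping does not affect the comparison of a crossing with [u]. Parallel lines
    divide by 0 and get key 0, but [pre] and [post] coincide on them. *)
Lemma cand_lex u j k : 0 <= u -> (k < n)%N -> cand j u k = lex u j k.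
Proof.
move=> u0 kn; rewrite /cand /post /pre /lex /key kn /above_tie /=.
case: (ltgtP (x k) (x j)) => [xx|xx|->]; last first.
- rewrite subrr invr0 mulr0 maxxx u0 ltrD2r.
  by rewrite (inj_eq (addIr _)).
- rewrite andbF orbF ge_max u0 /= ler_pdivrMr ?subr_gt0 //.
  case: (leP (y k - y j)) => h; last by rewrite (_ : y j - u * x j < y k - u * x k) //; lra.
  apply: esym.
  by apply: negbTE; rewrite -leNgt; lra.
- rewrite ge_max u0 /= ler_ndivrMr ?subr_lt0 //= andbT.
  by case: (leP (u * _)) => h; case: ltgtP => //; lra.
Qed.

Lemma lexP u j k :
  reflect (y j - u * x j < y k - u * x k \/ (y k - u * x k = y j - u * x j /\
    (x k < x j \/ (x k = x j /\ (j <= k)%N)))) (lex u j k).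
Proof.
apply: (iffP idP); rewrite /lex.
  move=> /orP[|/andP[/eqP -> /orP[|/andP[/eqP -> ->]]]]; [by left|by right; split; auto|].
  by right; split=> //; right.
case=> [->//|[-> [->|[-> ->]]]]; first by rewrite eqxx orbT.
by rewrite !eqxx !orbT.
Qed.

Lemma lex_refl u j : lex u j j.
Proof. by apply/lexP; right; split=> //; right. Qed.

Lemma lex_anti u j k : lex u j k -> lex u k j -> j = k.
Proof.
move=> /lexP jk /lexP kj.
case: jk => [h|[h jk]]; case: kj => [h'|[h' kj]]; try by exfalso; lra.
case: jk => [d|[d jk]]; case: kj => [d'|[d' kj]]; try by exfalso; lra.
by apply/eqP; rewrite eqn_leq jk kj.
Qed.

Lemma lex_trans u j k l : lex u j k -> lex u k l -> lex u j l.
Proof.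
move=> /lexP jk /lexP kl; apply/lexP.
case: jk => [h|[h jk]]; case: kl => [h'|[h' kl]]; try by left; lra.
right; split; first by rewrite h' h.
case: jk => [d|[d jk]]; case: kl => [d'|[d' kl]]; try by left; lra.
by right; split; [rewrite d' d|exact: leq_trans kl].
Qed.

Lemma lex_total u j k : lex u j k || lex u k j.
Proof.
apply/orP; case: (ltgtP (y j - u * x j) (y k - u * x k)) => h.
- by left; apply/lexP; left.
- by right; apply/lexP; left.
case: (ltgtP (x j) (x k)) => d.
- by right; apply/lexP; right; split=> //; left.
- by left; apply/lexP; right; split=> //; left.
case: (leqP j k) => jk; [left|right]; apply/lexP; right; split=> //; right; split=> //.
exact: ltnW.
Qed.

(** [lex u] is a total order, so the upper sets of the products in [A := cand_set j0 u] form a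
    strict chain of nonempty subsets of [A]. Their sizes are #|A| distinct numbers in 1..#|A|, hence
    all of them. *)
Lemma rank_exists u j0 C :
  0 <= u -> (0 < C)%N -> (C <= #|cand_set j0 u|)%N ->
  exists2 j : 'I_n, j \in cand_set j0 u & #|cand_set j u| = C.
Proof.
move=> u0 C0 CA; set A := cand_set j0 u.
have inS (j : nat) (k : 'I_n) : (k \in cand_set j u) = lex u j k.
  by rewrite inE cand_lex.
have refl (j : 'I_n) : j \in cand_set j u by rewrite inS lex_refl.
have sub (j : nat) (k : 'I_n) : k \in cand_set j u -> cand_set k u \subset cand_set j u.
  rewrite inS => jk; apply/subsetP => l; rewrite !inS; exact: lex_trans.
have inj : {in A &, injective (fun j : 'I_n => #|cand_set j u|)}.
  move=> j k _ _ /= jk; apply: val_inj => /=.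
  wlog jk' : j k jk / lex u j k.
    move=> W; case/orP: (lex_total u j k) => [|kj]; first exact: W.
    by apply/esym/W.
  have /eqP E : cand_set k u == cand_set j u.
    by rewrite eqEcard sub ?inS //= jk.
  by apply: (lex_anti jk'); rewrite -inS E refl.
case: (boolP [exists j : 'I_n, (j \in A) && (#|cand_set j u| == C)]).
  by move=> /existsP[j /andP[jA /eqP jC]]; exists j.
rewrite negb_exists => /forallP no.
(* Pigeonhole: were [C] missed, #|A| distinct sizes would fit into a list of length #|A| - 1. *)
have : (size [seq #|cand_set j u| | j : 'I_n <- enum A] <= size (rem C (iota 1 #|A|)))%N.
  apply: uniq_leq_size.
    by rewrite map_inj_in_uniq ?enum_uniq // => j k; rewrite !mem_enum; exact: inj.
  move=> _ /mapP[j + ->]; rewrite mem_enum => jA.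
  rewrite mem_rem_uniq ?iota_uniq // !inE mem_iota.
  have := no j; rewrite jA /= => -> /=.
  rewrite add1n ltnS subset_leq_card ?sub // andbT card_gt0.
  by apply/set0Pn; exists j.
rewrite size_rem ?mem_iota ?C0 ?add1n ?ltnS // size_iota size_map -cardE.
by rewrite -/A in CA *; rewrite leqNgt ltn_predL (leq_trans C0 CA).
Qed.

(** The set of the dummy consists of the products strictly above the zero line. If it fits the
    capacity, it is best with threshold 0; otherwise [rank_exists] supplies a member whose own upper
    set has exactly [C] elements, and its height, the threshold, is nonnegative. *)
Lemma best_linear u C :
  0 <= u -> (0 < C)%N -> (forall k, 0 <= x k) -> x n = 0 -> y n = 0 ->
  exists j, [/\ (j <= n)%N, (#|cand_set j u| <= C)%N & forall A : {set 'I_n},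
    (#|A| <= C)%N -> \sum_(k in A) (y k - u * x k) <=
                     \sum_(k in cand_set j u) (y k - u * x k)].
Proof.
move=> u0 C0 x0 xn yn.
have inS (j : nat) (k : 'I_n) : (k \in cand_set j u) = lex u j k.
  by rewrite inE cand_lex.
have thS (j : nat) (k : 'I_n) : y j - u * x j < y k - u * x k -> k \in cand_set j u.
  by move=> h; rewrite inS; apply/lexP; left.
have Sth (j : nat) (k : 'I_n) : k \in cand_set j u -> y j - u * x j <= y k - u * x k.
  by rewrite inS => /lexP[/ltW//|[-> _]].
case: (leqP #|cand_set n u| C) => CS.
  exists n; split=> // A AC.
  apply: (@threshold_sum_max _ _ _ (y n - u * x n)) => //.
  - by rewrite yn xn mulr0 subr0.
  - by move=> k; exact: thS.
  - by move=> k; exact: Sth.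
  - by left; rewrite yn xn mulr0 subr0.
have [j jS jC] := rank_exists u0 C0 (ltnW CS).
exists j; split; [exact: ltnW|by rewrite jC|move=> A AC].
apply: (@threshold_sum_max _ _ _ (y j - u * x j)) => //.
- by have := Sth _ _ jS; rewrite yn xn mulr0 subr0.
- by move=> k; exact: thS.
- by move=> k; exact: Sth.
- by right; rewrite jC.
Qed.

(** The set depends on [u] only through the crossings passed, so [u] may be lowered to the largest
    key not above it. The sentinel key 0 of the dummy guarantees that there is one. *)
Lemma cand_key j u :
  0 <= u -> exists2 l, (l <= n)%N & cand_set j (key j l) = cand_set j u.
Proof.
move=> u0.
have P0 : key j (@ord_max n) <= u by rewrite /key ltnn.
case: (@arg_maxP _ _ _ ord_max (fun l : 'I_n.+1 => key j l <= u) (fun l => key j l) P0).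
move=> l lu lmax; exists l; first by rewrite -ltnS.
apply/setP => k; rewrite !inE /cand.
have -> // : (key j k <= key j l) = (key j k <= u).
apply/idP/idP => h; first exact: le_trans lu.
exact: (lmax (widen_ord (leqnSn n) k)).
Qed.

(** Past the last crossing of the zero line no product is above it, as all slopes are at most 0 and
    a product of weight 0 has the zero line itself. This provides the fallback for nests where no
    set has positive value. *)
Lemma cand_empty :
  (forall k, 0 <= x k) -> (forall k, x k = 0 -> y k = 0) -> x n = 0 ->
  exists2 l, (l <= n)%N & cand_set n (key n l) = set0.
Proof.
move=> x0 xy xn.
case: (@arg_maxP _ _ _ (@ord_max n) predT (fun l : 'I_n.+1 => key n l) isT) => l _ lmax.
exists l; first by rewrite -ltnS.
apply/setP => k; rewrite !inE /cand.
have -> : key n k <= key n l by exact: (lmax (widen_ord (leqnSn n) k)).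
rewrite /post ltn_ord /above_tie xn /=.
case: eqP => [xk|_]; last by rewrite ltNge x0.
by rewrite (xy _ xk) (xy _ xn) ltxx eqxx leqNgt ltn_ord.
Qed.

End Candidates.

(** * From the attraction of a nest to a linear objective *)

Section Attraction.

Variable R : realType.
Implicit Types (g V W z t : R).

(* The exponential lies above its tangent at [l * ln t]; combine the bounds at
   0 and at [ln t] with weights [1 - l] and [l]. *)
Lemma powR_le_affine t l : 0 < t -> 0 <= l -> l <= 1 -> t `^ l <= 1 - l + l * t.
Proof.
move=> t0 l0 l1; rewrite /powR gt_eqF //.
set a := l * ln t.
have e0 := expR_ge1Dx (- a).
have e1 := expR_ge1Dx (ln t - a).
have tE : t = expR a * expR (ln t - a) by rewrite -expRD addrC subrK lnK.
have oE : 1 = expR a * expR (- a) by rewrite -expRD addrN expR0.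
have ea : 0 < expR a by exact: expR_gt0.
have -> : 1 - l + l * t =
    expR a * ((1 - l) * expR (- a) + l * expR (ln t - a)).
  by rewrite mulrDr (mulrCA _ (1 - l)) -oE (mulrCA _ l) -tE mulr1.
rewrite ler_peMr ?(ltW ea) //.
have : (1 - l) * (1 - a) + l * (1 + (ln t - a)) <=
       (1 - l) * expR (- a) + l * expR (ln t - a).
  by apply: lerD; apply: ler_wpM2l => //; lra.
by apply: le_trans; rewrite /a; lra.
Qed.

Definition attraction g V W z := V `^ g * (W / V) - z * V `^ g.

(** In the plane of pairs (V', W') the level curve of the attraction through (V, W) is W' = z V' + D
    (V'/V)^(1-g) with D = W - z V > 0. It is concave and [u] is its slope at V, so the tangent there
    lies above it. The hypothesis puts (V', W') on or above the tangent, hence on or above the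
    curve. *)
Lemma attraction_max g V W V' W' z :
  0 < g -> g <= 1 -> 0 < V -> 0 < V' -> 0 < W - z * V ->
  let u := z + (1 - g) * ((W - z * V) / V) in
  W - u * V <= W' - u * V' -> attraction g V W z <= attraction g V' W' z.
Proof.
move=> g0 g1 V0 V'0 D0 u; rewrite /u => H.
have aE U X : 0 < U -> attraction g U X z = U `^ g / U * (X - z * U).
  by move=> U0; rewrite /attraction; field; lra.
rewrite !aE //; set D := W - z * V in D0 H *.
have p0 : 0 < V `^ g by exact: powR_gt0.
have p'0 : 0 < V' `^ g by exact: powR_gt0.
have t0 : 0 < V' / V by exact: divr_gt0.
have := @powR_le_affine (V' / V) (1 - g) t0.
have -> : (V' / V) `^ (1 - g) = V' / V * (V `^ g / V' `^ g).
  rewrite /powR !gt_eqF // ln_div ?posrE //.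
  rewrite -{2}(lnK (x := V')) ?posrE // -{2}(lnK (x := V)) ?posrE //.
  rewrite -!expRN -!expRD; congr expR; ring.
have l0 : 0 <= 1 - g by lra.
have l1 : 1 - g <= 1 by lra.
move=> /(_ l0 l1) B.
have D'B : D * (V' / V * (V `^ g / V' `^ g)) <= W' - z * V'.
  apply: (le_trans (ler_wpM2l (ltW D0) B)).
  have -> : D * (1 - (1 - g) + (1 - g) * (V' / V)) =
    D - (1 - g) * (D / V) * V + (1 - g) * (D / V) * V' by field; lra.
  move: H; rewrite /D; lra.
have c0 : 0 <= V' `^ g / V' by apply: divr_ge0; exact: ltW.
apply: le_trans (ler_wpM2l c0 D'B).
have -> // : V' `^ g / V' * (D * (V' / V * (V `^ g / V' `^ g))) = V `^ g / V * D.
by field; rewrite !gt_eqF.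
Qed.

End Attraction.

Section Maxto.

Variable R : realType.

(** The start value 0 is that of the program's accumulator. It is below every envelope at the root,
    since the empty set contributes the zero line. *)
Fixpoint maxto (f : nat -> R) (N : nat) : R :=
  if N is N'.+1 then Num.max (maxto f N') (f N') else 0.

Lemma maxto_ge f N k : (k < N)%N -> f k <= maxto f N.
Proof.
elim: N => // N IH; rewrite ltnS leq_eqVlt /= le_max => /orP[/eqP ->|/IH ->] //.
by rewrite lexx orbT.
Qed.

Lemma maxto_le f N c : 0 <= c -> (forall k, (k < N)%N -> f k <= c) -> maxto f N <= c.
Proof.
move=> c0; elim: N => //= N IH fc; rewrite ge_max fc // andbT.
by apply: IH => k kN; apply: fc; exact: ltnW.
Qed.

End Maxto.

(** * Lines of a nest and the root equation *)

Section Nests.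

Variables (R : realType) (m n : nat) (I : instance R m n).

(* Position [n] is the dummy item. *)
Definition item_weight (i : 'I_m) (k : nat) : R :=
  if insub k is Some j then weight I i j else 0.

Definition item_value (i : 'I_m) (k : nat) : R :=
  if insub k is Some j then revenue I i j * weight I i j else 0.

Definition nest_cand (i : 'I_m) (j : nat) (u : R) : {set 'I_n} :=
  cand_set n (item_weight i) (item_value i) j u.

Definition nest_key (i : 'I_m) (j l : nat) : R :=
  key n (item_weight i) (item_value i) j l.

Definition line_b (i : 'I_m) (S : {set 'I_n}) : R := nest_weight I i S `^ dissim I i.

(** Written without the case distinction of [nest_revenue], in the form the program evaluates;
    division by 0 yields 0. *)
Definition line_a (i : 'I_m) (S : {set 'I_n}) : R :=
  line_b i S * ((\sum_(j in S) revenue I i j * weight I i j) / nest_weight I i S).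

Lemma item_weight_ord i (k : 'I_n) : item_weight i k = weight I i k.
Proof. by rewrite /item_weight valK. Qed.

Lemma item_value_ord i (k : 'I_n) : item_value i k = revenue I i k * weight I i k.
Proof. by rewrite /item_value valK. Qed.

Lemma item_weight_dummy i : item_weight i n = 0.
Proof. by rewrite /item_weight insubF // ltnn. Qed.

Lemma item_value_dummy i : item_value i n = 0.
Proof. by rewrite /item_value insubF // ltnn. Qed.

Lemma item_weight_ge0 i k : 0 <= item_weight i k.
Proof. by rewrite /item_weight; case: insub => // j; exact: weight_ge0. Qed.

Lemma item_value0 i k : item_weight i k = 0 -> item_value i k = 0.
Proof. by rewrite /item_weight /item_value; case: insub => // j ->; rewrite mulr0. Qed.

Lemma nest_weight_ge0 i S : 0 <= nest_weight I i S.
Proof. by apply: sumr_ge0 => j _; exact: weight_ge0. Qed.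

Lemma line_b_ge0 i S : 0 <= line_b i S.
Proof. exact: powR_ge0. Qed.

Lemma line_aE i S : line_a i S = nest_weight I i S `^ dissim I i * nest_revenue I i S.
Proof.
rewrite /line_a /line_b /nest_revenue; case: eqP => // ->.
by rewrite invr0 mulr0.
Qed.

Lemma line_a_ge0 i S : 0 <= line_a i S.
Proof.
apply: mulr_ge0; first exact: line_b_ge0.
apply: divr_ge0; last exact: nest_weight_ge0.
by apply: sumr_ge0 => j _; apply: mulr_ge0; [exact: revenue_ge0|exact: weight_ge0].
Qed.

Lemma line_b0 i : line_b i set0 = 0.
Proof.
rewrite /line_b /nest_weight big_set0 powR0 //.
by rewrite gt_eqF // dissim_gt0.
Qed.

Lemma line_a0 i : line_a i set0 = 0.
Proof. by rewrite /line_a line_b0 mul0r. Qed.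

Lemma line_attraction i (S : {set 'I_n}) (z : R) :
  line_a i S - line_b i S * z =
  attraction (dissim I i) (nest_weight I i S)
    (\sum_(j in S) revenue I i j * weight I i j) z.
Proof. by rewrite /attraction /line_a /line_b (mulrC z). Qed.

(* The best set of a nest at [z] also maximizes the linear functional
   [W - u V] for [u = z + (1 - gamma) (R - z)], which [best_linear] handles. *)
Lemma nest_cand_complete (i : 'I_m) (z : R) (S : {set 'I_n}) :
  0 <= z -> (#|S| <= capacity I i)%N ->
  exists j l, [/\ (j <= n)%N, (l <= n)%N,
    (#|nest_cand i j (nest_key i j l)| <= capacity I i)%N &
    line_a i S - line_b i S * z <=
    line_a i (nest_cand i j (nest_key i j l)) -
    line_b i (nest_cand i j (nest_key i j l)) * z].
Proof.
move=> z0 SC.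
case: (lerP (line_a i S - line_b i S * z) 0) => pos.
  have [l ln E] := cand_empty (item_weight_ge0 i) (@item_value0 i) (item_weight_dummy i).
  exists n, l; rewrite /nest_cand /nest_key E cards0 line_a0 line_b0 mul0r subr0.
  by split.
have V0 : 0 < nest_weight I i S.
  rewrite lt_neqAle nest_weight_ge0 andbT eq_sym; apply/eqP => V0; move: pos.
  rewrite /line_a /line_b V0 powR0; first by rewrite !mul0r subr0 ltxx.
  by rewrite gt_eqF // dissim_gt0.
set g := dissim I i; set V := nest_weight I i S in V0 *.
set W := \sum_(j in S) revenue I i j * weight I i j.
have g0 : 0 < g by exact: dissim_gt0.
have g1 : g <= 1 by exact: dissim_le1.
have D0 : 0 < W - z * V.
  move: pos; rewrite line_attraction -/g -/V -/W.
  have -> : attraction g V W z = V `^ g / V * (W - z * V).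
    by rewrite /attraction; field; rewrite gt_eqF.
  by rewrite pmulr_rgt0 // divr_gt0 // powR_gt0.
have C0 : (0 < capacity I i)%N.
  apply: leq_trans SC; rewrite card_gt0; apply/eqP => S0.
  by move: V0; rewrite /V /nest_weight S0 big_set0 ltxx.
set u := z + (1 - g) * ((W - z * V) / V).
have u0 : 0 <= u.
  apply: addr_ge0 => //; apply: mulr_ge0; first lra.
  by apply: divr_ge0; exact: ltW.
have [j [jn jC jmax]] :=
  best_linear u0 C0 (item_weight_ge0 i) (item_weight_dummy i) (item_value_dummy i).
have [l ln E] := @cand_key _ n (item_weight i) (item_value i) j u u0.
exists j, l; rewrite /nest_cand /nest_key E; split=> //.
set S' := cand_set n (item_weight i) (item_value i) j u in jC jmax *.
have := jmax S SC.
have sumE (A : {set 'I_n}) : \sum_(k in A) (item_value i k - u * item_weight i k) =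
    (\sum_(k in A) revenue I i k * weight I i k) - u * nest_weight I i A.
  rewrite sumrB -mulr_sumr; congr (_ - _ * _).
    by apply: eq_bigr => k _; rewrite item_value_ord.
  by apply: eq_bigr => k _; rewrite item_weight_ord.
rewrite !sumE -/V -/W => H.
rewrite !line_attraction -/g -/V -/W; apply: attraction_max => //.
(* A set of weight 0 has value 0 for the linear objective, whereas [S] has value W - u V = g (W - z
   V) > 0, so the maximizer cannot have weight 0. *)
rewrite lt_neqAle nest_weight_ge0 andbT eq_sym; apply/eqP => V'0.
have W'0 : \sum_(k in S') revenue I i k * weight I i k = 0.
  move/eqP: V'0; rewrite psumr_eq0 => [/allP V'0|k _]; last exact: weight_ge0.
  apply: big1 => k kS; have /implyP /(_ kS) /eqP -> := V'0 k (mem_index_enum k).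
  by rewrite mulr0.
move: H; rewrite V'0 W'0 mulr0 subr0.
have -> : W - u * V = g * (W - z * V).
  by rewrite /u; field; rewrite gt_eqF.
by rewrite leNgt mulr_gt0.
Qed.

Lemma expected_revenueE (S : assortment m n) :
  expected_revenue I S =
  (\sum_i line_a i (S i)) / (weight0 I + \sum_i line_b i (S i)).
Proof.
rewrite /expected_revenue; congr (_ / _).
by apply: eq_bigr => i _; rewrite line_aE.
Qed.

Lemma denominator_gt0 (S : assortment m n) : 0 < weight0 I + \sum_i line_b i (S i).
Proof.
apply: ltr_wpDr; last exact: weight0_gt0.
by apply: sumr_ge0 => i _; exact: line_b_ge0.
Qed.

(** Clearing the positive denominator makes the fractional objective separable: for fixed [z] each
    nest contributes its own line. *)
Lemma expected_revenue_le (S : assortment m n) (z : R) :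
  (expected_revenue I S <= z) =
  (\sum_i (line_a i (S i) - line_b i (S i) * z) <= weight0 I * z).
Proof.
rewrite expected_revenueE ler_pdivrMr ?denominator_gt0 //.
rewrite sumrB -mulr_suml lerBlDr mulrC mulrDl.
by [].
Qed.

Lemma expected_revenue_eq (S : assortment m n) (z : R) :
  (expected_revenue I S = z) <->
  (\sum_i (line_a i (S i) - line_b i (S i) * z) = weight0 I * z).
Proof.
rewrite expected_revenueE sumrB -mulr_suml; split.
  move=> <-; set b := \sum_i line_b i (S i); set a := \sum_i line_a _ _.
  by field; rewrite gt_eqF // denominator_gt0.
move=> /eqP; rewrite subr_eq -mulrDl => /eqP ->.
by rewrite mulrC mulKf // gt_eqF // denominator_gt0.
Qed.

Lemma optimal_exists : exists S, optimal I S.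
Proof.
pose feas (S : assortment m n) := [forall i, (#|S i| <= capacity I i)%N].
have f0 : feas [ffun=> set0] by apply/forallP => i; rewrite ffunE cards0.
case: (@arg_maxP _ _ _ [ffun=> set0] feas (expected_revenue I) f0) => S fS Smax.
have FS : feasible I S by move=> i; exact: (forallP fS).
exists S; split=> //; split; first by exists S.
by move=> S' fS'; apply: Smax; apply/forallP.
Qed.

(* [a] and [b] hold [L] lines per nest, line [t] of nest [i] at [t * m + i]. *)
Definition lines_sound (L : nat) (a b : nat -> R) : Prop :=
  forall (i : 'I_m) t, (t < L)%N -> exists S : {set 'I_n},
    [/\ (#|S| <= capacity I i)%N, a (t * m + i)%N = line_a i S
      & b (t * m + i)%N = line_b i S].

Definition lines_complete (L : nat) (a b : nat -> R) : Prop :=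
  forall (i : 'I_m) (S : {set 'I_n}) z, 0 <= z -> (#|S| <= capacity I i)%N ->
    exists2 t, (t < L)%N & line_a i S - line_b i S * z <=
                           a (t * m + i)%N - b (t * m + i)%N * z.

(** [f i] is the height at [z] of the upper envelope of nest [i]. *)
Definition envelope_root (L : nat) (a b : nat -> R) (z : R) (f : 'I_m -> R) : Prop :=
  [/\ 0 <= z, is_max_revenue I z, \sum_i f i = weight0 I * z &
      forall i : 'I_m, [/\ 0 <= f i,
        exists2 t, (t < L)%N & a (t * m + i)%N - b (t * m + i)%N * z = f i
      & forall t, (t < L)%N -> a (t * m + i)%N - b (t * m + i)%N * z <= f i]].

(** The root is the optimal revenue. Soundness turns the highest lines at [z] into a feasible
    assortment, so the sum of the heights is at most [weight0 I * z]; completeness dominates the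
    lines of an optimal assortment, which gives the other inequality. *)
Lemma envelope_root_exists L a b :
  lines_sound L a b -> lines_complete L a b -> exists z f, envelope_root L a b z f.
Proof.
move=> snd cpl; have [So [fSo [_ So_max]]] := optimal_exists.
set z := expected_revenue I So in So_max *.
have z0 : 0 <= z.
  rewrite /z expected_revenueE; apply: divr_ge0; last exact: ltW (denominator_gt0 _).
  by apply: sumr_ge0 => i _; exact: line_a_ge0.
have mx : is_max_revenue I z by split=> //; exists So.
have L0 (i : 'I_m) : (0 < L)%N.
  have [|t tL _] := cpl i set0 z z0; first by rewrite cards0.
  exact: leq_ltn_trans tL.
pose v (i : 'I_m) t := a (t * m + i)%N - b (t * m + i)%N * z.
have ex (i : 'I_m) : exists t, (t < L)%N /\ forall t', (t' < L)%N -> v i t' <= v i t.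
  case: (@arg_maxP _ _ _ (Ordinal (L0 i)) predT (fun t : 'I_L => v i t) isT) => t _ tmax.
  exists t; split=> // t' t'L; exact: (tmax (Ordinal t'L)).
have [t Ht] := boolp.choice ex.
exists z, (fun i => v i (t i)); split=> //; last first.
  move=> i; split; last 2 first.
  - by exists (t i) => //; case: (Ht i).
  - by case: (Ht i).
  have [|t' t'L] := cpl i set0 z z0; first by rewrite cards0.
  rewrite line_a0 line_b0 mul0r subr0 => /le_trans; apply.
  by case: (Ht i) => _; apply.
apply/eqP; rewrite eq_le; apply/andP; split.
  have /boolp.choice[S HS] := fun i => snd i (t i) (Ht i).1.
  have fS : feasible I (finfun S) by move=> i; rewrite ffunE; case: (HS i).
  have := So_max _ fS; rewrite expected_revenue_le; apply: le_trans.
  apply: ler_sum => i _; rewrite ffunE /v; case: (HS i) => _ -> ->.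
  exact: lexx.
have /expected_revenue_eq <- : expected_revenue I So = z by [].
apply: ler_sum => i _.
have [t' t'L /le_trans] := cpl i (So i) z z0 (fSo i); apply.
by case: (Ht i) => _; apply.
Qed.

End Nests.

(** * Sweeping the crossings of one line *)

Section SortedPrefix.

Variables (R : realType) (key : nat -> R) (P : nat -> nat) (N : nat).
Hypothesis P_perm : perm_eq (sub P 0 N) (iota 0 N).
Hypothesis P_sorted : sorted (key_le key) (sub P 0 N).

Lemma sorted_key_le a b : (a <= b)%N -> (b < N)%N -> key (P a) <= key (P b).
Proof.
move=> ab bN; have aN : (a < N)%N by exact: leq_ltn_trans bN.
have tr : transitive (key_le key) by move=> i j k; exact: le_trans.
have re : reflexive (key_le key) by move=> i; exact: lexx.
have := @sorted_leq_nth _ _ tr re 0%N _ P_sorted a b.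
by rewrite !inE size_sub subn0 !nth_sub // => /(_ aN bN ab).
Qed.

Lemma sorted_perm_lt t : (t < N)%N -> (P t < N)%N.
Proof.
move=> tN; have : P t \in sub P 0 N by rewrite /sub subn0 map_f // mem_iota.
by rewrite (perm_mem P_perm) mem_iota.
Qed.

(** Inside a group of equal keys only part of the simultaneous crossings has been processed. A
    prefix of the sorted order is a sublevel set of the keys at the end of a group. *)
Definition last_of_ties (t : nat) : bool := (t.+1 == N) || (key (P t) < key (P t.+1)).

Lemma sum_sorted_prefix (V : nmodType) (f : nat -> V) t :
  (t < N)%N -> last_of_ties t ->
  \sum_(0 <= s < t.+1) f (P s) = \sum_(0 <= k < N | key k <= key (P t)) f k.
Proof.
move=> tN lt.
have -> : \sum_(0 <= k < N | key k <= key (P t)) f k =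
          \sum_(0 <= s < N | key (P s) <= key (P t)) f (P s).
  rewrite /index_iota subn0 -(perm_big _ P_perm) /sub subn0 big_map.
  by apply: eq_bigl => s.
rewrite [RHS](big_cat_nat (n := t.+1)) //=.
rewrite [X in _ = _ + X]big_nat_cond [X in _ = _ + X]big_pred0 ?addr0; last first.
  move=> s; apply/negbTE; apply/negP => /andP[/andP[ts sN] le_s].
  case/orP: lt => [/eqP E|lt]; first by rewrite E in ts; rewrite leqNgt sN in ts.
  by have := lt_le_trans lt (sorted_key_le ts sN); rewrite ltNge le_s.
rewrite [RHS]big_nat_cond [LHS]big_nat_cond; apply: eq_bigl => s /=.
case: (ltnP s t.+1) => //= st; first by rewrite sorted_key_le.
Qed.

Lemma last_of_ties_exists l :
  (l < N)%N -> exists t, [/\ (t < N)%N, last_of_ties t & key (P t) = key l].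
Proof.
move=> lN.
have : l \in sub P 0 N by rewrite (perm_mem P_perm) mem_iota.
move=> /mapP[t0]; rewrite subn0 mem_iota => /andP[_ t0N] lE.
case: (@arg_maxnP _ (Ordinal t0N) (fun t : 'I_N => key (P t) == key l) val) => /=.
  by rewrite lE.
move=> t /eqP tl tmax; exists t; split=> //.
rewrite /last_of_ties; case: eqP => //= /eqP tN.
have tN' : (t.+1 < N)%N by rewrite ltn_neqAle tN ltn_ord.
rewrite lt_neqAle sorted_key_le // andbT; apply/eqP => E.
by have := tmax (Ordinal tN'); rewrite /= -E tl eqxx => /(_ isT); rewrite ltnn.
Qed.

End SortedPrefix.

Section CandSums.

Variables (R : realType) (n : nat) (x y : nat -> R) (j : nat) (u : R).

Let ky := key n x y j.
Let pr := pre n x y j.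
Let po := post n x y j.
Let cd := cand n x y j u.

(** Insertions and removals are counted separately and the identity is additive, because subtraction
    of indices is truncated. [cand_sum] is the signed version for the real sums. *)
Lemma cand_count :
  (\sum_(0 <= k < n.+1) pr k + \sum_(0 <= k < n.+1 | (ky k <= u)%R) po k =
   #|cand_set n x y j u| + \sum_(0 <= k < n.+1 | (ky k <= u)%R) pr k)%N.
Proof.
have -> : #|cand_set n x y j u| = (\sum_(0 <= k < n.+1) cd k)%N.
  rewrite big_nat_recr //= big_mkord -sum1_card big_mkcond /=.
  rewrite {2}/cd /cand /pre /post ltnn /= if_same addn0.
  by apply: eq_bigr => k _; rewrite inE -/(cd k); case: (cd k).
rewrite [in LHS](big_mkcond (fun k => ky k <= u)) [in RHS](big_mkcond (fun k => ky k <= u)).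
rewrite -!big_split; apply: eq_bigr => k _ /=.
by rewrite /cd /cand -/(ky k) -/(pr k) -/(po k); case: ifP => _; rewrite ?addn0 // addnC.
Qed.

Lemma cand_sum (f : nat -> R) :
  \sum_(0 <= k < n.+1) (pr k)%:R * f k +
  \sum_(0 <= k < n.+1 | ky k <= u) ((po k)%:R - (pr k)%:R) * f k =
  \sum_(k in cand_set n x y j u) f k.
Proof.
have -> : \sum_(k in cand_set n x y j u) f k = \sum_(0 <= k < n.+1) (cd k)%:R * f k.
  rewrite big_nat_recr //= big_mkord big_mkcond /=.
  rewrite {2}/cd /cand /pre /post ltnn /= if_same mul0r addr0.
  by apply: eq_bigr => k _; rewrite inE -/(cd k); case: (cd k); rewrite ?mul1r ?mul0r.
rewrite (big_mkcond (fun k => ky k <= u)) -big_split; apply: eq_bigr => k _ /=.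
rewrite /cd /cand -/(ky k) -/(pr k) -/(po k); case: ifP => _; last by rewrite addr0.
by rewrite mulrBl addrC subrK.
Qed.

End CandSums.

(** * Programs that sweep the crossings and record the candidate lines *)

Notation aPRE := 6%N (only parsing).
Notation aPOST := 7%N (only parsing).
Notation aJJ := 8%N (only parsing).
Notation aQQ := 9%N (only parsing).
Notation xI := 20%N (only parsing).
Notation xJ := 21%N (only parsing).
Notation xK := 22%N (only parsing).
Notation xBASE := 23%N (only parsing).
Notation xPP := 24%N (only parsing).
Notation xCP := 25%N (only parsing).
Notation xCM := 26%N (only parsing).
Notation xMT := 27%N (only parsing).
Notation rX := 6%N (only parsing).
Notation rY := 7%N (only parsing).
Notation rA := 8%N (only parsing).
Notation rB := 9%N (only parsing).
Notation rU := 10%N (only parsing).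
Notation rSV := 11%N (only parsing).
Notation rSW := 12%N (only parsing).

Definition load_cmd : cmd :=
  For xK (nv 1)
    (RSet rX (nv xK) (RGet 2 (NAdd (nv xBASE) (nv xK))) ;;
     RSet rY (nv xK) (RMul (RGet 3 (NAdd (nv xBASE) (nv xK)))
                           (RGet 2 (NAdd (nv xBASE) (nv xK))))) ;;
  RSet rX (nv 1) RZero ;;
  RSet rY (nv 1) RZero.

Definition keys_body : cmd :=
  RSet rKEY (nv xK) (RDiv (RSub (RGet rY (nv xK)) (RGet rY (nv xJ)))
                          (RSub (RGet rX (nv xK)) (RGet rX (nv xJ)))) ;;
  If (RLe (RGet rKEY (nv xK)) RZero) (RSet rKEY (nv xK) RZero) Skip ;;
  NSet aPERM (nv xK) (nv xK) ;;
  If (RLe (RGet rX (nv xK)) (RGet rX (nv xJ)))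
    (If (RLe (RGet rX (nv xJ)) (RGet rX (nv xK)))
      (If (TAnd (RLe (RGet rY (nv xJ)) (RGet rY (nv xK)))
             (TNot (TAnd (RLe (RGet rY (nv xK)) (RGet rY (nv xJ)))
                         (NLt (nv xK) (nv xJ)))))
        (NSet aPRE (nv xK) (NConst 1) ;; NSet aPOST (nv xK) (NConst 1))
        (NSet aPRE (nv xK) (NConst 0) ;; NSet aPOST (nv xK) (NConst 0)))
      (NSet aPRE (nv xK) (NConst 0) ;; NSet aPOST (nv xK) (NConst 1)))
    (NSet aPRE (nv xK) (NConst 1) ;; NSet aPOST (nv xK) (NConst 0)).

Definition keys_cmd : cmd :=
  For xK (nv 1) keys_body ;;
  RSet rKEY (nv 1) RZero ;;
  NSet aPERM (nv 1) (nv 1) ;;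
  NSet aPRE (nv 1) (NConst 0) ;;
  NSet aPOST (nv 1) (NConst 0).

Definition base_cmd : cmd :=
  rset rSV RZero ;;
  rset rSW RZero ;;
  nset xCP (NConst 0) ;;
  nset xCM (NConst 0) ;;
  For xK (NAdd (nv 1) (NConst 1))
    (If (NLe (NConst 1) (NGet aPRE (nv xK)))
      (rset rSV (RAdd (rv rSV) (RGet rX (nv xK))) ;;
       rset rSW (RAdd (rv rSW) (RGet rY (nv xK))) ;;
       nset xCP (NAdd (nv xCP) (NConst 1)))
      Skip).

Notation item := (NGet aPERM (nv xK)) (only parsing).

Definition sweep_move : cmd :=
  If (NLe (NConst 1) (NGet aPRE item))
    (rset rSV (RSub (rv rSV) (RGet rX item)) ;;
     rset rSW (RSub (rv rSW) (RGet rY item)) ;;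
     nset xCM (NAdd (nv xCM) (NConst 1)))
    Skip ;;
  If (NLe (NConst 1) (NGet aPOST item))
    (rset rSV (RAdd (rv rSV) (RGet rX item)) ;;
     rset rSW (RAdd (rv rSW) (RGet rY item)) ;;
     nset xCP (NAdd (nv xCP) (NConst 1)))
    Skip.

(** The first test is size <= capacity with the removals moved to the right, the second is
    [last_of_ties]. On failure the zero line is stored with the code n + 1 of the empty set, so that
    each sweep yields exactly n + 1 lines and all nests have equally many. *)
Definition sweep_record : cmd :=
  If (TAnd (NLe (nv xCP) (NAdd (NGet 2 (nv xI)) (nv xCM)))
       (TNot (TAnd (NLt (nv xK) (nv 1))
          (RLe (RGet rKEY (NGet aPERM (NAdd (nv xK) (NConst 1)))) (RGet rKEY item)))))
    (RSet rA (nv xPP) (RMul (RPow (rv rSV) (nv xI)) (RDiv (rv rSW) (rv rSV))) ;;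
     RSet rB (nv xPP) (RPow (rv rSV) (nv xI)) ;;
     NSet aJJ (nv xPP) (nv xJ) ;;
     RSet rU (nv xPP) (RGet rKEY item))
    (RSet rA (nv xPP) RZero ;;
     RSet rB (nv xPP) RZero ;;
     NSet aJJ (nv xPP) (NAdd (nv 1) (NConst 1)) ;;
     RSet rU (nv xPP) RZero) ;;
  NSet aQQ (nv xPP) (nv xPP) ;;
  nset xPP (NAdd (nv xPP) (nv 0)).

Definition sweep_cmd : cmd :=
  For xK (NAdd (nv 1) (NConst 1)) (sweep_move ;; sweep_record).

Definition slot (R : Type) (s : memory R) (p : nat) :=
  (rmem s rA p, rmem s rB p, nmem s aJJ p, rmem s rU p, nmem s aQQ p).

Section Sweep.

Variables (R : realType) (g : nat -> R).
Implicit Types s : memory R.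

Lemma load_spec s n base (xs ys : nat -> R) :
  nmem s 1 0%N = n -> nmem s xBASE 0%N = base ->
  (forall k, (k < n)%N -> rmem s 2 (base + k)%N = xs k) ->
  (forall k, (k < n)%N -> rmem s 3 (base + k)%N * rmem s 2 (base + k)%N = ys k) ->
  xs n = 0 -> ys n = 0 ->
  run g load_cmd s ((n + 1) * 100) (fun s' =>
    forall k, (k <= n)%N -> rmem s' rX k = xs k /\ rmem s' rY k = ys k).
Proof.
move=> sn sb sx sy xn yn.
apply: (@run_leq _ _ _ _ ((n * (40 + 20) + 20) + 20)).
- lia.
rewrite /load_cmd; apply: run_seq.
  apply: (@run_for _ _ _ _ _ _ n 40 (fun k s' =>
    forall l, (l < k)%N -> rmem s' rX l = xs l /\ rmem s' rY l = ys l)) => //.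
  - by move=> k s' kn sk Pk ag /=; rewrite ag.1.
  move=> k s' kn sk Pk ag; apply: run_wp => //=.
  have x2 : rmem s' 2 = rmem s 2 by rewrite ag.2.
  have x3 : rmem s' 3 = rmem s 3 by rewrite ag.2.
  have xb : nmem s' xBASE 0%N = base by rewrite ag.1.
  rewrite /update /= sk xb x2 x3 => l; rewrite ltnS leq_eqVlt.
  by case: eqP => [->|_] //=; [rewrite sy ?sx|exact: Pk].
move=> s1 a1 /= P1; apply: run_wp => //=.
rewrite /update /= a1.1 // sn => k; rewrite leq_eqVlt.
by case: eqP => [->|_] //=; exact: P1.
Qed.

Definition key_data n (x y : nat -> R) j s k :=
  [/\ rmem s rKEY k = key n x y j k, nmem s aPERM k = k,
      nmem s aPRE k = pre n x y j k & nmem s aPOST k = post n x y j k].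

Lemma keys_spec s n j :
  nmem s 1 0%N = n -> nmem s xJ 0%N = j ->
  run g keys_cmd s ((n + 1) * 200) (fun s' => forall k, (k <= n)%N ->
    key_data n (rmem s rX) (rmem s rY) j s' k).
Proof.
move=> sn sj.
set Q := key_data n (rmem s rX) (rmem s rY) j.
apply: (@run_leq _ _ _ _ ((n * (150 + 20) + 20) + 40)).
- lia.
rewrite /keys_cmd; apply: run_seq.
{ apply: (@run_for _ _ _ _ _ _ n 150 (fun k s' => forall l, (l < k)%N -> Q s' l)) => //.
  - by move=> k s' kn sk Pk ag /=; rewrite ag.1.
  move=> k s' kn sk Pk ag; apply: run_wp => //=.
  have xX : rmem s' rX = rmem s rX by rewrite ag.2.
  have xY : rmem s' rY = rmem s rY by rewrite ag.2.
  have xj : nmem s' xJ 0%N = j by rewrite ag.1.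
  rewrite /update /= sk xX xY xj addn1 !eqxx.
  set c := _ / _.
  case: (lerP c 0) => c0; rewrite /= ?sk ?xX ?xY ?xj ?addn1;
    (case: (lerP (rmem s 6 k) _) => xx;
      [case: (lerP (rmem s 6 j) _) => xx'; [case: ifP => tie|]|]);
    move=> l; rewrite ltnS leq_eqVlt /Q /key_data /= ?sk;
    case: eqP => [->|/eqP lk] //= lk';
    try exact: (Pk l lk').
  all: split=> //; rewrite /key /pre /post /above_tie kn -/c /=.
  all: try (by rewrite max_l // ltW).
  all: try (by rewrite max_r // ltW).
  all: try (by rewrite max_l).
  all: try (by rewrite (lt_eqF xx') ltNge xx).
  all: try (by rewrite (lt_eqF xx') xx').
  all: try (by rewrite (gt_eqF xx) xx).
  all: try (by rewrite (gt_eqF xx) ltNge (ltW xx)).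
  all: have -> : rmem s 6 k == rmem s 6 j by rewrite eq_le xx xx'.
  all: move: tie; rewrite ltnNge; case: (ltgtP (rmem s 7 j) (rmem s 7 k)) => //= _.
  all: by case: (leqP j k). }
move=> s1 a1 /= P1; apply: run_wp => //=.
have E : nmem s1 1 0%N = n by rewrite a1.1.
rewrite /update /= !E => k; rewrite leq_eqVlt /Q /key_data /=.
case: eqP => [-> _|_] /=; last exact: P1.
by rewrite /key /pre /post ltnn.
Qed.

Lemma base_spec s n (p : nat -> bool) :
  nmem s 1 0%N = n -> (forall k, (k <= n)%N -> nmem s aPRE k = p k) ->
  run g base_cmd s ((n + 1) * 100) (fun s' =>
    [/\ rmem s' rSV 0%N = \sum_(0 <= k < n.+1) (p k)%:R * rmem s rX k,
        rmem s' rSW 0%N = \sum_(0 <= k < n.+1) (p k)%:R * rmem s rY k,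
        nmem s' xCP 0%N = (\sum_(0 <= k < n.+1) p k)%N
      & nmem s' xCM 0%N = 0%N]).
Proof.
move=> sn sp.
apply: (@run_leq _ _ _ _ (3 + (3 + (3 + (3 + (n.+1 * (40 + 20) + 20)))))).
- lia.
rewrite /base_cmd; do 4!apply: run_seqwp => /=.
apply: (@run_for _ _ _ _ _ _ n.+1 40 (fun t s' =>
    [/\ rmem s' rSV 0%N = \sum_(0 <= k < t) (p k)%:R * rmem s rX k,
        rmem s' rSW 0%N = \sum_(0 <= k < t) (p k)%:R * rmem s rY k,
        nmem s' xCP 0%N = (\sum_(0 <= k < t) p k)%N
      & nmem s' xCM 0%N = 0%N])) => //.
- by rewrite !big_geq.
- by move=> k s' kn sk Pk ag /=; rewrite ag.1 //= /update /= sn addn1.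
move=> k s' kn sk [sv sw cp cm] ag; apply: run_wp => //=.
have xX : rmem s' rX = rmem s rX by rewrite ag.2.
have xY : rmem s' rY = rmem s rY by rewrite ag.2.
have xP : nmem s' aPRE k = p k by rewrite ag.1 // /= /update /= sp.
rewrite /update /= sk xP xX xY sv sw cp !big_nat_recr //=.
by case: (p k); rewrite /= ?cm ?mul1r ?mul0r ?addr0 ?addn0.
Qed.

End Sweep.

Section SweepLoop.

Variables (R : realType) (g : nat -> R).
Implicit Types s : memory R.

Definition sweep_entry (n j C : nat) (x y ky : nat -> R) (P : nat -> nat) (e : R)
    (t p : nat) : R * R * nat * R * nat :=
  let S := cand_set n x y j (ky (P t)) in
  let V := \sum_(k in S) x k in
  if last_of_ties ky P n.+1 t && (#|S| <= C)%N then
    (V `^ e * ((\sum_(k in S) y k) / V), V `^ e, j, ky (P t), p)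
  else (0, 0, n.+1, 0, p).

Lemma sweep_spec s m n i j C pp :
  nmem s 0 0%N = m -> nmem s 1 0%N = n -> nmem s xI 0%N = i -> nmem s 2 i = C ->
  nmem s xJ 0%N = j -> nmem s xPP 0%N = pp -> (0 < m)%N ->
  let x := rmem s rX in let y := rmem s rY in
  let ky := rmem s rKEY in let P := nmem s aPERM in
  (forall k, (k <= n)%N -> [/\ ky k = key n x y j k,
     nmem s aPRE k = pre n x y j k & nmem s aPOST k = post n x y j k]) ->
  perm_eq (sub P 0 n.+1) (iota 0 n.+1) -> sorted (key_le ky) (sub P 0 n.+1) ->
  rmem s rSV 0%N = \sum_(0 <= k < n.+1) (pre n x y j k)%:R * x k ->
  rmem s rSW 0%N = \sum_(0 <= k < n.+1) (pre n x y j k)%:R * y k ->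
  nmem s xCP 0%N = (\sum_(0 <= k < n.+1) pre n x y j k)%N ->
  nmem s xCM 0%N = 0%N ->
  run g sweep_cmd s ((n + 1) * 500) (fun s' =>
    [/\ nmem s' xPP 0%N = (pp + n.+1 * m)%N,
        forall t, (t < n.+1)%N -> slot s' (pp + t * m) =
          sweep_entry n j C x y ky P (g i) t (pp + t * m)
      & forall p, (forall t, (t < n.+1)%N -> p != (pp + t * m)%N) ->
          slot s' p = slot s p]).
Proof.
move=> sm sn si sC sj spp m0 x y ky P kd Pperm Psort sv0 sw0 cp0 cm0.
set pr := pre n x y j in kd sv0 sw0 cp0; set po := post n x y j in kd.
have Plt t : (t < n.+1)%N -> (P t < n.+1)%N by exact: sorted_perm_lt.
(* The accumulators follow these sums at every [t], although inside a group of ties they need not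
   describe a set; [cut] identifies them with a candidate set where a group ends. *)
pose sum (f : nat -> R) t := \sum_(0 <= k < n.+1) (pr k)%:R * f k +
  \sum_(0 <= r < t) ((po (P r))%:R - (pr (P r))%:R) * f (P r).
pose acc t s' := [/\ rmem s' rSV 0%N = sum x t, rmem s' rSW 0%N = sum y t,
  nmem s' xCP 0%N = (\sum_(0 <= k < n.+1) pr k + \sum_(0 <= r < t) po (P r))%N
  & nmem s' xCM 0%N = (\sum_(0 <= r < t) pr (P r))%N].
have cut t : (t < n.+1)%N -> last_of_ties ky P n.+1 t ->
   [/\ sum x t.+1 = \sum_(k in cand_set n x y j (ky (P t))) x k,
       sum y t.+1 = \sum_(k in cand_set n x y j (ky (P t))) y k
     & (\sum_(0 <= k < n.+1) pr k + \sum_(0 <= r < t.+1) po (P r) =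
       #|cand_set n x y j (ky (P t))| + \sum_(0 <= r < t.+1) pr (P r))%N].
  move=> tn lt.
  have E (V : nmodType) (f : nat -> V) : \sum_(0 <= r < t.+1) f (P r) =
      \sum_(0 <= k < n.+1 | key n x y j k <= ky (P t)) f k.
    rewrite (sum_sorted_prefix Pperm Psort _ tn lt).
    rewrite [LHS]big_nat_cond [RHS]big_nat_cond; apply: eq_bigl => k /=.
    by case: (ltnP k n.+1) => //= kn; have [-> _ _] := kd k kn.
  have En (f : nat -> nat) : (\sum_(0 <= r < t.+1) f (P r) =
      \sum_(0 <= k < n.+1 | (key n x y j k <= ky (P t))%R) f k)%N.
    exact: (E nat f).
  split.
  - by rewrite /sum (E _ (fun k => ((po k)%:R - (pr k)%:R) * x k)) cand_sum.
  - by rewrite /sum (E _ (fun k => ((po k)%:R - (pr k)%:R) * y k)) cand_sum.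
  - by rewrite (En (fun k => po k)) (En (fun k => pr k)) cand_count.
pose Inv t s' := acc t s' /\
   [/\ nmem s' xPP 0%N = (pp + t * m)%N,
       forall t', (t' < t)%N -> slot s' (pp + t' * m) =
          sweep_entry n j C x y ky P (g i) t' (pp + t' * m)
      & forall p, (forall t', (t' < t)%N -> p != (pp + t' * m)%N) ->
          slot s' p = slot s p].
apply: (@run_imp _ _ _ _ (n.+1 * (400 + 20) + 20) _ (Inv n.+1)); last 2 first.
- lia.
- by move=> s' _ [].
apply: (@run_for _ _ _ _ _ _ n.+1 400 Inv) => //.
- rewrite /Inv mul0n addn0; split; last by split.
  by rewrite /acc /sum /= !(@big_geq _ _ _ 0%N 0%N) ?addr0 ?addn0.
- by move=> k s' kn sk Pk ag /=; rewrite ag.1 //= sn addn1.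
move=> t s' tn st [[sv sw cp cm] [s'pp old keep]] ag.
have aX : rmem s' rX = x by rewrite ag.2.
have aY : rmem s' rY = y by rewrite ag.2.
have aK : rmem s' rKEY = ky by rewrite ag.2.
have aP : nmem s' aPERM = P by rewrite ag.1.
have aPr : nmem s' aPRE (P t) = pr (P t).
  by rewrite ag.1 //; have [] := kd _ (Plt _ tn).
have aPo : nmem s' aPOST (P t) = po (P t).
  by rewrite ag.1 //; have [] := kd _ (Plt _ tn).
have sumS f : sum f t.+1 = sum f t + ((po (P t))%:R - (pr (P t))%:R) * f (P t).
  by rewrite /sum -addrA; congr (_ + _); rewrite big_nat_recr.
have poS : (\sum_(0 <= r < t.+1) po (P r) = \sum_(0 <= r < t) po (P r) + po (P t))%N.
  by rewrite big_nat_recr.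
have prS : (\sum_(0 <= r < t.+1) pr (P r) = \sum_(0 <= r < t) pr (P r) + pr (P t))%N.
  by rewrite big_nat_recr.
apply: (@run_leq _ _ _ _ (200 + 200)) => //.
apply: (run_seq (Q1 := acc t.+1)).
{ apply: run_wp => //=.
  rewrite /update /= st aP aPr aPo aX aY sv sw cp cm.
  rewrite /acc !sumS poS prS.
  case: (pr (P t)); case: (po (P t)); rewrite /= ?aPo ?st ?aP ?sv ?sw ?cp ?cm ?aX ?aY.
  all: by split; rewrite ?(addn0, addn1, addnA, subrr, subr0, sub0r, mul0r, addr0,
    mul1r, mulN1r, subrK). }
move=> s1 a1 [sv1 sw1 cp1 cm1].
have [c1 c2 c3] : [/\ nmem s1 2 i = C, nmem s1 xI 0%N = i & nmem s1 xK 0%N = t].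
  by split; rewrite a1.1 // ag.1.
have [d1 d2 d3] : [/\ nmem s1 aPERM = P, rmem s1 rKEY = ky & nmem s1 1 0%N = n].
  by split; rewrite ?a1.1 ?a1.2 // ag.1.
have [e1 e2 e3] : [/\ nmem s1 xPP 0%N = (pp + t * m)%N, nmem s1 xJ 0%N = j
    & nmem s1 0 0%N = m].
  by split; rewrite a1.1 // ag.1.
have slot1 p : slot s1 p = slot s' p by rewrite /slot !a1.1 // !a1.2.
have tE : (last_of_ties ky P n.+1 t) =
   ~~ ((t.+1 <= n)%N && (ky (P t.+1) <= ky (P t))).
  rewrite /last_of_ties eqSS; case: (ltngtP t n) tn => //= [_ _|?]; last by lia.
  by rewrite -ltNge.
have posE t' : (t' < t)%N -> (pp + t' * m == pp + t * m)%N = false.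
  move=> t't; apply/negbTE; rewrite eqn_add2l eqn_pmul2r //; lia.
apply: run_wp => //=.
have final s2 : nmem s2 xPP 0%N = (pp + t * m + m)%N ->
    rmem s2 rSV 0%N = rmem s1 rSV 0%N -> rmem s2 rSW 0%N = rmem s1 rSW 0%N ->
    nmem s2 xCP 0%N = nmem s1 xCP 0%N -> nmem s2 xCM 0%N = nmem s1 xCM 0%N ->
    slot s2 (pp + t * m) = sweep_entry n j C x y ky P (g i) t (pp + t * m) ->
    (forall p, p != (pp + t * m)%N -> slot s2 p = slot s1 p) ->
    acc t.+1 s2 /\
    [/\ nmem s2 xPP 0%N = (pp + t.+1 * m)%N,
        forall t', (t' < t.+1)%N -> slot s2 (pp + t' * m) =
          sweep_entry n j C x y ky P (g i) t' (pp + t' * m)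
      & forall p, (forall t', (t' < t.+1)%N -> p != (pp + t' * m)%N) ->
          slot s2 p = slot s p].
  move=> p2 f1 f2 f3 f4 new other; split; first by rewrite /acc f1 f2 f3 f4.
  split.
  - by rewrite p2 mulSn; lia.
  - move=> t'; rewrite ltnS leq_eqVlt => /orP[/eqP -> //|t't].
    by rewrite other ?posE // slot1 old.
  - move=> p ne; rewrite other ?ne // slot1 keep // => t' t't.
    by apply: ne; exact: ltnW.
rewrite /update /= c2 c1 c3 d1 d2 d3 e1 e2 e3 addn1 -tE.
case: ifP => [/andP[cnt lt]|no]; rewrite /= ?c2 ?e1 ?e2 ?e3 ?c3 ?d1 ?d2 ?d3 ?sv1 ?sw1.
  have [Ex Ey Ec] := cut t tn lt.
  apply: final => //=; rewrite ?e1 ?e2 ?e3 //.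
    rewrite /slot /sweep_entry /= !eqxx Ex Ey lt /=.
    move: cnt; rewrite cp1 cm1 Ec leq_add2r => -> //.
  by move=> p /negbTE ne; rewrite /slot /= ne.
apply: final => //=; rewrite ?e1 ?e2 ?e3 //.
  rewrite /slot /sweep_entry /= !eqxx addn1.
  case: ifP => // /andP[lt cnt]; move: no; rewrite lt andbT.
  have [_ _ Ec] := cut t tn lt.
  by rewrite cp1 cm1 Ec leq_add2r cnt.
by move=> p /negbTE ne; rewrite /slot /= ne.
Qed.

End SweepLoop.

Definition line_cmd : cmd :=
  keys_cmd ;;
  nset xNUM (NAdd (nv 1) (NConst 1)) ;;
  sort_cmd ;;
  base_cmd ;;
  sweep_cmd.

Definition nest_cmd : cmd :=
  load_cmd ;;
  nset xPP (nv xI) ;;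
  For xJ (NAdd (nv 1) (NConst 1)) line_cmd.

(** After the last nest [xPP] holds (n + 1)^2 * m + (m - 1); adding 1 and subtracting m gives the
    total number of lines without a multiplication. *)
Definition lines_cmd : cmd :=
  nset xBASE (NConst 0) ;;
  For xI (nv 0) (nest_cmd ;; nset xBASE (NAdd (nv xBASE) (nv 1))) ;;
  nset xMT (NSub (NAdd (nv xPP) (NConst 1)) (nv 0)).

Section CandExt.

Variables (R : realType) (n : nat) (x y x' y' : nat -> R).
Hypothesis xx' : forall k, (k <= n)%N -> x k = x' k /\ y k = y' k.

(** The arrays in memory agree with the item functions only up to position [n], so equality is
    transferred pointwise. *)
Lemma key_ext j k : (j <= n)%N -> key n x y j k = key n x' y' j k.
Proof.
move=> jn; rewrite /key; case: ltnP => // /ltnW kn.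
by case: (xx' jn) => -> ->; case: (xx' kn) => -> ->.
Qed.

Lemma pre_ext j k : (j <= n)%N -> pre n x y j k = pre n x' y' j k.
Proof.
move=> jn; rewrite /pre /above_tie; case: ltnP => //= /ltnW kn.
by case: (xx' jn) => -> ->; case: (xx' kn) => -> ->.
Qed.

Lemma post_ext j k : (j <= n)%N -> post n x y j k = post n x' y' j k.
Proof.
move=> jn; rewrite /post /above_tie; case: ltnP => //= /ltnW kn.
by case: (xx' jn) => -> ->; case: (xx' kn) => -> ->.
Qed.

Lemma cand_set_ext j u : (j <= n)%N -> cand_set n x y j u = cand_set n x' y' j u.
Proof.
move=> jn; apply/setP => k; rewrite !inE /cand key_ext // pre_ext // post_ext //.
Qed.

End CandExt.

Section Lines.

Variables (R : realType) (m n : nat) (I : instance R m n).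
Implicit Types (s : memory R) (i : 'I_m).
Let g := exponents I.

(* The set named by the code [(j, u)] of a line; [j > n] encodes the empty set. *)
Definition coded_set i (j : nat) (u : R) : {set 'I_n} :=
  if (j <= n)%N then nest_cand I i j u else set0.

Definition sound_slot i s p : Prop :=
  let S := coded_set i (nmem s aJJ p) (rmem s rU p) in
  [/\ nmem s aQQ p = p, (#|S| <= capacity I i)%N, rmem s rA p = line_a I i S
    & rmem s rB p = line_b I i S].

Definition has_line i s p (S : {set 'I_n}) : Prop :=
  rmem s rA p = line_a I i S /\ rmem s rB p = line_b I i S.

Lemma sound_slot_eq i s s' p : slot s' p = slot s p -> sound_slot i s p -> sound_slot i s' p.
Proof. by move=> [a b c d e]; rewrite /sound_slot a b c d e. Qed.

Lemma has_line_eq i s s' p S : slot s' p = slot s p -> has_line i s p S -> has_line i s' p S.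
Proof. by move=> [a b c d e]; rewrite /has_line a b. Qed.

Lemma line_spec s i j x0 e :
  nmem s 0 0%N = m -> nmem s 1 0%N = n -> nmem s xI 0%N = i ->
  nmem s 2 i = capacity I i -> nmem s xJ 0%N = j -> (j <= n)%N ->
  nmem s xPP 0%N = (x0 * m + i)%N ->
  (forall k, (k <= n)%N ->
    rmem s rX k = item_weight I i k /\ rmem s rY k = item_value I i k) ->
  (n.+1 <= 2 ^ e)%N ->
  run g line_cmd s ((n + 1) * (e + 1) * 2000) (fun s' =>
    [/\ nmem s' xPP 0%N = ((x0 + n.+1) * m + i)%N,
        forall t, (x0 <= t < x0 + n.+1)%N -> sound_slot i s' (t * m + i),
        forall l, (l <= n)%N -> (#|nest_cand I i j (nest_key I i j l)| <= capacity I i)%N ->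
          exists2 t, (x0 <= t < x0 + n.+1)%N &
            has_line i s' (t * m + i) (nest_cand I i j (nest_key I i j l))
      & forall p, (forall t, (t < n.+1)%N -> p != ((x0 + t) * m + i)%N) ->
          slot s' p = slot s p]).
Proof.
move=> sm sn si sC sj jn spp sxy ne.
have m0 : (0 < m)%N by exact: leq_ltn_trans (ltn_ord i).
apply: (@run_leq _ _ _ _ ((n + 1) * 200 + (6 + ((n.+1 + 1) * (e + 1) * 500
   + ((n + 1) * 100 + (n + 1) * 500))))).
- nia.
set x := rmem s rX in sxy *; set y := rmem s rY in sxy *.
rewrite /line_cmd; apply: run_seq; first exact: (keys_spec g sn sj).
move=> s1 a1 kd; apply: run_seqwp => /=.
set s2 := nput _ _ _ _.
have n2 a : a != xNUM -> nmem s2 a = nmem s1 a by move=> aN; rewrite /s2 /= update_other.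
have r2 : rmem s2 = rmem s1 by [].
have s2N : nmem s2 xNUM 0%N = n.+1 by rewrite /s2 /= /update /= a1.1 // sn addn1.
apply: run_seq; first exact: (sort_spec g s2N ne).
move=> s3 a3 [srt prm].
have P0 : sub (nmem s2 aPERM) 0 n.+1 = iota 0 n.+1.
  rewrite n2 // -[RHS]map_id /sub subn0; apply/eq_in_map => k.
  by rewrite mem_iota => kn; have [] := kd k kn.
rewrite P0 in prm.
have n3 : nmem s3 1 0%N = n by rewrite a3.1 // n2 // a1.1.
apply: run_seq.
  apply: (@base_spec _ _ _ n (pre n x y j)) => // k kn.
  by rewrite a3.1 // n2 //; have [] := kd k kn.
move=> s4 a4 [sv sw cp cm].
have n4 a : a \notin [:: xK; xCP; xCM] -> nmem s4 a = nmem s3 a.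
  by move=> aN; rewrite a4.1 //; move: aN; rewrite /= !inE !negb_or => /and3P[-> -> ->].
have x4 : rmem s4 rX = x by rewrite a4.2 // a3.2 // r2 a1.2.
have y4 : rmem s4 rY = y by rewrite a4.2 // a3.2 // r2 a1.2.
have k4 : rmem s4 rKEY = rmem s1 rKEY by rewrite a4.2 // a3.2.
have x3 : rmem s3 rX = x by rewrite a3.2 // r2 a1.2.
have y3 : rmem s3 rY = y by rewrite a3.2 // r2 a1.2.
have p4 : nmem s4 aPERM = nmem s3 aPERM by rewrite n4.
have slot4 p : slot s4 p = slot s p.
  rewrite /slot; congr (_, _, _, _, _).
  - by rewrite a4.2 // a3.2 // r2 a1.2.
  - by rewrite a4.2 // a3.2 // r2 a1.2.
  - by rewrite n4 // a3.1 // n2 // a1.1.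
  - by rewrite a4.2 // a3.2 // r2 a1.2.
  - by rewrite n4 // a3.1 // n2 // a1.1.
have kd4 k : (k <= n)%N -> [/\ rmem s4 rKEY k = key n x y j k,
     nmem s4 aPRE k = pre n x y j k & nmem s4 aPOST k = post n x y j k].
  move=> kn; rewrite k4 !n4 // !a3.1 // !n2 //.
  by have [] := kd k kn.
have := @sweep_spec _ g s4 m n i j (capacity I i) (x0 * m + i).
rewrite x4 y4 k4 p4.
have f0 : nmem s4 0 0%N = m by rewrite n4 // a3.1 // n2 // a1.1.
have f1 : nmem s4 1 0%N = n by rewrite n4.
have f2 : nmem s4 xI 0%N = i by rewrite n4 // a3.1 // n2 // a1.1.
have f3 : nmem s4 2 i = capacity I i by rewrite n4 // a3.1 // n2 // a1.1.
have f4 : nmem s4 xJ 0%N = j by rewrite n4 // a3.1 // n2 // a1.1.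
have f5 : nmem s4 xPP 0%N = (x0 * m + i)%N by rewrite n4 // a3.1 // n2 // a1.1.
move=> /(_ f0 f1 f2 f3 f4 f5 m0).
rewrite k4 in kd4; move=> /(_ kd4 prm srt).
rewrite sv sw x3 y3 => /(_ erefl erefl cp cm)/run_imp; apply=> //.
move=> s5 a5 [p5 sl5 keep5].
have pos t : (x0 * m + i + t * m = (x0 + t) * m + i)%N by rewrite mulnDl; lia.
have gi : g i = dissim I i by rewrite /g /exponents valK.
have key1 k : (k <= n)%N -> rmem s1 rKEY k = nest_key I i j k.
  by move=> kn; have [-> _ _ _] := kd k kn; exact: (key_ext sxy).
have cs u : cand_set n x y j u = nest_cand I i j u by exact: (cand_set_ext sxy).
have sumx (S : {set 'I_n}) : \sum_(k in S) x k = nest_weight I i S.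
  apply: eq_bigr => k _; case: (sxy k (ltnW (ltn_ord k))) => -> _.
  by rewrite item_weight_ord.
have sumy (S : {set 'I_n}) : \sum_(k in S) y k = \sum_(k in S) revenue I i k * weight I i k.
  apply: eq_bigr => k _; case: (sxy k (ltnW (ltn_ord k))) => _ ->.
  by rewrite item_value_ord.
have Plt t : (t < n.+1)%N -> (nmem s3 aPERM t < n.+1)%N by exact: sorted_perm_lt.
split.
- by rewrite p5 pos.
- move=> t /andP[x0t tn]; have tE : t = (x0 + (t - x0))%N by lia.
  have tn' : (t - x0 < n.+1)%N by lia.
  rewrite tE; move: (t - x0)%N tn' => {tE x0t tn}t tn.
  move: (sl5 t tn); rewrite pos /sweep_entry cs sumx sumy gi.
  case: ifP => [/andP[_ cnt]|_]; rewrite /sound_slot /slot => -[-> -> -> -> ->].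
    by rewrite /coded_set jn.
  by rewrite /coded_set ltnn cards0 line_a0 line_b0.
- move=> l ln cnt.
  (* Crossings with the same key give the same set, which is recorded at the end of their group. *)
  have [t [tn lt kt]] := last_of_ties_exists prm srt (ln : (l < n.+1)%N).
  exists (x0 + t)%N; first by lia.
  have kE : rmem s1 rKEY (nmem s3 aPERM t) = nest_key I i j l.
    by rewrite -(key1 l ln) kt.
  move: (sl5 t tn); rewrite pos /sweep_entry cs lt kE cnt /= sumx sumy gi.
  by rewrite /has_line /slot => -[-> -> _ _ _].
- by move=> p pne; rewrite keep5 ?slot4 // => t tn; rewrite pos; exact: pne.
Qed.

Lemma nest_spec s i e :
  input I s -> nmem s xI 0%N = i -> nmem s xBASE 0%N = (i * n)%N -> (n.+1 <= 2 ^ e)%N ->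
  run g nest_cmd s ((n + 1) * (n + 1) * (e + 1) * 3000) (fun s' =>
    [/\ nmem s' xPP 0%N = (n.+1 * n.+1 * m + i)%N,
        forall t, (t < n.+1 * n.+1)%N -> sound_slot i s' (t * m + i),
        forall j l, (j <= n)%N -> (l <= n)%N ->
          (#|nest_cand I i j (nest_key I i j l)| <= capacity I i)%N ->
          exists2 t, (t < n.+1 * n.+1)%N &
            has_line i s' (t * m + i) (nest_cand I i j (nest_key I i j l))
      & forall t (i' : 'I_m), i' != i -> slot s' (t * m + i') = slot s (t * m + i')]).
Proof.
move=> [[sm sn] sC [sv0 _] sw sr] si sb ne.
apply: (@run_leq _ _ _ _ ((n + 1) * 100 + (4 +
   (n.+1 * ((n + 1) * (e + 1) * 2000 + 20) + 20)))).
- nia.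
rewrite /nest_cmd; apply: run_seq.
  apply: (@load_spec _ _ _ n (i * n) (item_weight I i) (item_value I i)) => //.
  - by move=> k kn; rewrite (sw i (Ordinal kn)) (item_weight_ord I i (Ordinal kn)).
  - move=> k kn; rewrite (sw i (Ordinal kn)) (sr i (Ordinal kn)).
    by rewrite (item_value_ord I i (Ordinal kn)).
  - exact: item_weight_dummy.
  - exact: item_value_dummy.
move=> s1 a1 sxy; apply: run_seqwp => /=.
set s2 := nput _ _ _ _.
have slot2 p : slot s2 p = slot s p.
  by rewrite /slot /s2 /= /update /= !a1.1 // !a1.2.
(* The nest is the residue of the position modulo [m], so lines of different nests never share a
   cell. *)
have inj t t' (i' : 'I_m) : (t * m + i == t' * m + i')%N -> i' = i.
  move=> /eqP E; apply: val_inj => /=.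
  by rewrite -(modn_small (ltn_ord i')) -(modn_small (ltn_ord i)) -(modnMDl t') -E modnMDl.
pose Inv j s' := [/\ nmem s' xPP 0%N = (j * n.+1 * m + i)%N,
        forall t, (t < j * n.+1)%N -> sound_slot i s' (t * m + i),
        forall j' l, (j' < j)%N -> (l <= n)%N ->
          (#|nest_cand I i j' (nest_key I i j' l)| <= capacity I i)%N ->
          exists2 t, (t < j * n.+1)%N &
            has_line i s' (t * m + i) (nest_cand I i j' (nest_key I i j' l))
      & forall t (i' : 'I_m), i' != i -> slot s' (t * m + i') = slot s (t * m + i')].
apply: (@run_for _ _ _ _ _ _ n.+1 _ Inv) => //.
- split=> //; first by rewrite /= /update /= a1.1 // si.
  by move=> t i' _; exact: slot2.
- by move=> j s' jn sj _ ag /=; rewrite ag.1 // /s2 /= update_other // a1.1 // sn addn1.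
move=> j s' jn sj [pp snd cpl keep] ag.
have fr a : a \notin [:: xK; xPP] -> a \notin nwrites (For xJ (NAdd (nv 1) (NConst 1)) line_cmd) ->
    nmem s' a = nmem s a.
  move=> + aw; rewrite !inE negb_or => /andP[aK aP].
  rewrite ag.1 // /s2 /= update_other // a1.1 // /= !inE.
  by rewrite !(negbTE aK).
have slot' p s3 : slot (nput s3 xJ 0%N j.+1) p = slot s3 p by [].
have := @line_spec s' i j (j * n.+1) e.
move=> /(_ _ _ _ _ sj jn pp _ ne) H.
apply: (run_imp (H _ _ _ _ _)); rewrite ?fr //.
  move=> k kn; have [<- <-] := sxy k kn.
  by rewrite !ag.2.
move=> s3 a3 [pp3 snd3 cpl3 keep3].
have old3 t : (t < j * n.+1)%N -> slot s3 (t * m + i) = slot s' (t * m + i).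
  move=> tj; apply: keep3 => t' t'n; rewrite eqn_add2r.
  have m0 : (0 < m)%N by exact: leq_ltn_trans (ltn_ord i).
  by rewrite eqn_pmul2r //; lia.
split.
- by rewrite /= /update /= pp3 mulSnr.
- move=> t tj; apply: (@sound_slot_eq i s3) => //.
  case: (ltnP t (j * n.+1)) => tj'.
    by apply: (@sound_slot_eq i s') (snd t tj'); exact: old3.
  by apply: snd3; rewrite tj' /=; move: tj; rewrite mulSnr.
- move=> j' l; rewrite ltnS leq_eqVlt => /orP[/eqP ->|j'j] ln cnt.
    have [t /andP[_ tj] H'] := cpl3 l ln cnt.
    exists t; first by rewrite mulSnr.
    by apply: (@has_line_eq i s3) H'.
  have [t tj H'] := cpl j' l j'j ln cnt.
  exists t; first by rewrite mulSn; lia.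
  apply: (@has_line_eq i s3) => //; apply: (@has_line_eq i s') H'; exact: old3.
- move=> t i' i'i; rewrite slot' keep3 ?keep // => t' _.
  by apply: contra i'i => /eqP E; apply/eqP/(@inj (j * n.+1 + t')%N t); rewrite E.
Qed.

Lemma lines_spec s e :
  input I s -> (0 < m)%N -> (n.+1 <= 2 ^ e)%N ->
  run g lines_cmd s (m * (n + 1) * (n + 1) * (e + 1) * 4000) (fun s' =>
    [/\ nmem s' xMT 0%N = (n.+1 * n.+1 * m)%N,
        forall i t, (t < n.+1 * n.+1)%N -> sound_slot i s' (t * m + i),
        lines_sound I (n.+1 * n.+1) (rmem s' rA) (rmem s' rB)
      & lines_complete I (n.+1 * n.+1) (rmem s' rA) (rmem s' rB)]).
Proof.
move=> inp m0 ne; have [[sm sn] sC [sv0 sd] sw sr] := inp.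
pose Inv k s' := [/\ nmem s' xBASE 0%N = (k * n)%N,
        (0 < k)%N -> nmem s' xPP 0%N = (n.+1 * n.+1 * m + k.-1)%N
      & forall i, (i < k)%N ->
         (forall t, (t < n.+1 * n.+1)%N -> sound_slot i s' (t * m + i)) /\
         forall j l, (j <= n)%N -> (l <= n)%N ->
          (#|nest_cand I i j (nest_key I i j l)| <= capacity I i)%N ->
          exists2 t, (t < n.+1 * n.+1)%N &
            has_line i s' (t * m + i) (nest_cand I i j (nest_key I i j l))].
apply: (@run_imp _ _ _ _ (3 + ((m * ((n + 1) * (n + 1) * (e + 1) * 3000 + 7 + 20) + 20) + 10))
  _ (fun s' => nmem s' xMT 0%N = (n.+1 * n.+1 * m)%N /\ Inv m s')); last 2 first.
- have h1 : (0 < m * (n + 1) * (n + 1) * (e + 1))%N by rewrite !muln_gt0 m0 !addn1.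
  have h2 : (m <= m * (n + 1) * (n + 1) * (e + 1))%N.
    by rewrite -!mulnA leq_pmulr // !muln_gt0 !addn1.
  have -> : (m * ((n + 1) * (n + 1) * (e + 1) * 3000 + 7 + 20) =
     m * (n + 1) * (n + 1) * (e + 1) * 3000 + m * 27)%N by ring.
  lia.
- move=> s' _ [mt [_ _ H]]; split=> //.
  + by move=> i t tL; case: (H i (ltn_ord i)) => + _; apply.
  + move=> i t tL; case: (H i (ltn_ord i)) => /(_ t tL)[_ c a b] _.
    by eexists; split; [exact: c|exact: a|exact: b].
  + move=> i S z z0 SC.
    have [j [l [jn ln c le]]] := nest_cand_complete z0 SC.
    case: (H i (ltn_ord i)) => _ /(_ j l jn ln c)[t tL [a b]].
    by exists t => //; rewrite a b.
rewrite /lines_cmd; apply: run_seqwp => /=; apply: run_seq.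
  apply: (@run_for _ _ _ _ _ _ m _ Inv) => //.
  - by move=> k s' km sk _ ag /=; rewrite ag.1.
  move=> k s' km sk [sb pp H] ag.
  have fr a : a != xBASE ->
      a \notin nwrites (For xI (nv 0) (nest_cmd ;; nset xBASE (NAdd (nv xBASE) (nv 1)))) ->
      nmem s' a = nmem s a.
    by move=> aB aw; rewrite ag.1 //= update_other.
  have inp' : input I s'.
    by split; rewrite ?fr // ?ag.2.
  apply: run_seq; first by apply: (@nest_spec s' (Ordinal km) e).
  move=> s1 a1 [pp1 snd1 cpl1 keep1]; apply: run_wp => //=.
  have slot2 p : slot (nput (nput s1 xBASE 0%N (nmem s1 xBASE 0%N + nmem s1 1 0%N)%N) xI 0%N k.+1) p
    = slot s1 p by [].
  split.
  - by rewrite /= /update /= !a1.1 // sb fr // sn mulSn addnC.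
  - by move=> _; rewrite /= /update /= pp1.
  - move=> i; rewrite ltnS leq_eqVlt => /orP[/eqP ik|ik].
      have -> : i = Ordinal km by exact: val_inj.
      split; first by move=> t tL; apply: (@sound_slot_eq _ s1) (snd1 t tL).
      move=> j l jn ln c; have [t tL h] := cpl1 j l jn ln c.
      by exists t => //; apply: (@has_line_eq _ s1) h.
    have ne' : i != Ordinal km by rewrite -val_eqE /= ltn_eqF.
    have [snd cpl] := H i ik; split.
      move=> t tL; apply: (@sound_slot_eq _ s') (snd t tL).
      by rewrite slot2 keep1.
    move=> j l jn ln c; have [t tL h] := cpl j l jn ln c.
    by exists t => //; apply: (@has_line_eq _ s') h; rewrite slot2 keep1.
move=> s1 a1 [sb pp H]; apply: run_wp => //=.
split; last by split.
rewrite /update /= pp // a1.1 //= /update /= sm; lia.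
Qed.

End Lines.

(** * Locating the root *)

Notation xHIN := 30%N (only parsing).
Notation xHSTEP := 31%N (only parsing).
Notation xHU := 32%N (only parsing).
Notation xHD := 33%N (only parsing).
Notation xDD := 34%N (only parsing).
Notation xHH := 35%N (only parsing).
Notation xQ := 36%N (only parsing).
Notation xBLO := 37%N (only parsing).
Notation xBHI := 38%N (only parsing).
Notation xBMID := 39%N (only parsing).
Notation xQP := 40%N (only parsing).
Notation rZZ := 13%N (only parsing).
Notation rFF := 14%N (only parsing).
Notation rYY := 15%N (only parsing).
Notation rTAU := 16%N (only parsing).

(** Two counters move towards each other in units of [xHSTEP] and stop at the upper and the lower
    half. With step m this halves the lines of each nest, with step 1 it finds the middle of a
    search interval. *)
Definition half_cmd : cmd :=
  nset xHU (NConst 0) ;;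
  nset xHD (nv xHIN) ;;
  While (NLt (nv xHU) (nv xHD))
    (nset xHU (NAdd (nv xHU) (nv xHSTEP)) ;;
     nset xHD (NSub (nv xHD) (nv xHSTEP))).

Notation line_value := (RSub (RGet rA (NGet aQQ (nv xQP)))
  (RMul (RGet rB (NGet aQQ (nv xQP))) (rv rZZ))) (only parsing).

Definition nest_max_loop : cmd :=
  While (NLt (nv xQP) (nv xMT))
    (If (RLe (rv rYY) line_value) (rset rYY line_value) Skip ;;
     nset xQP (NAdd (nv xQP) (nv 0))).

Definition eval_cmd : cmd :=
  rset rFF RZero ;;
  For xI (nv 0)
    (rset rYY RZero ;;
     nset xQP (nv xI) ;;
     nest_max_loop ;;
     rset rFF (RAdd (rv rFF) (rv rYY))).

Notation upper := (NGet aQQ (nv xQ)) (only parsing).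
Notation lower := (NGet aQQ (NAdd (nv xQ) (nv xHH))) (only parsing).
Notation slope_gap := (RSub (RGet rB upper) (RGet rB lower)) (only parsing).
Notation height_gap := (RSub (RGet rA upper) (RGet rA lower)) (only parsing).

Definition cross_cmd : cmd :=
  For xQ (nv xDD)
    (RSet rKEY (nv xQ) (RDiv height_gap slope_gap) ;;
     NSet aPERM (nv xQ) (nv xQ)).

Definition search_body : cmd :=
  nset xHIN (NSub (nv xBHI) (nv xBLO)) ;;
  nset xHSTEP (NConst 1) ;;
  half_cmd ;;
  nset xBMID (NAdd (nv xBLO) (nv xHD)) ;;
  rset rZZ (RGet rKEY (NGet aPERM (nv xBMID))) ;;
  eval_cmd ;;
  If (RLe (RMul (rv 0) (rv rZZ)) (rv rFF))
    (nset xBLO (NAdd (nv xBMID) (NConst 1)) ;;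
     If (RLe (rv rTAU) (rv rZZ)) (rset rTAU (rv rZZ)) Skip)
    (nset xBHI (nv xBMID)).

(** [rTAU] stands in for the unknown root: it ends as a number below the root such that a crossing
    is at most the root exactly when it is at most [rTAU]. The initial 0 is admissible because the
    root is nonnegative. *)
Definition search_cmd : cmd :=
  rset rTAU RZero ;;
  nset xBLO (NConst 0) ;;
  nset xBHI (nv xDD) ;;
  While (NLt (nv xBLO) (nv xBHI)) search_body.

Notation take_lower := (NSet aQQ (nv xQ) lower) (only parsing).

(** Upper minus lower line at the root z is height_gap - slope_gap * z. For a nonzero slope gap its
    sign follows from the sign of the gap and the side of the crossing on which z lies; parallel
    lines are compared by height, their stored crossing being meaningless. *)
Definition resolve_cmd : cmd :=
  For xQ (nv xDD)
    (If (RLe slope_gap RZero)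
      (If (RLe RZero slope_gap)
        (If (RLe height_gap RZero) take_lower Skip)
        (If (RLe (RGet rKEY (nv xQ)) (rv rTAU)) Skip take_lower))
      (If (RLe (RGet rKEY (nv xQ)) (rv rTAU)) take_lower Skip)).

Definition round_cmd : cmd :=
  nset xHIN (nv xMT) ;;
  nset xHSTEP (nv 0) ;;
  half_cmd ;;
  nset xDD (nv xHD) ;;
  nset xHH (nv xHU) ;;
  cross_cmd ;;
  nset xNUM (nv xDD) ;;
  sort_cmd ;;
  search_cmd ;;
  resolve_cmd ;;
  nset xMT (nv xHH).

Definition rounds_cmd : cmd := While (NLt (nv 0) (nv xMT)) round_cmd.

Lemma row_lt m i t L : (i < m)%N -> (t * m + i < L * m)%N = (t < L)%N.
Proof.
move=> im; apply/idP/idP => h; last by nia.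
by rewrite ltnNge; apply/negP => Lt; nia.
Qed.

Section Rounds.

Variables (R : realType) (g : nat -> R).
Implicit Types s : memory R.

Lemma half_spec s w step :
  nmem s xHIN 0%N = (w * step)%N -> nmem s xHSTEP 0%N = step -> (0 < step)%N ->
  run g half_cmd s (w * 40 + 40) (fun s' => exists a b,
    [/\ w = (a + b)%N, (b <= a)%N, (a <= b.+1)%N, nmem s' xHU 0%N = (a * step)%N
      & nmem s' xHD 0%N = (b * step)%N]).
Proof.
move=> sin sst st0.
pose P f s' := exists k, [/\ (k <= w)%N, (k <= w - k + 1)%N,
  nmem s' xHU 0%N = (k * step)%N, nmem s' xHD 0%N = ((w - k) * step)%N
  & f = ((w - k) * 40)%N].
apply: (@run_imp _ _ _ _ (3 + (4 + (w * 40 + (tcost (NLt (nv xHU) (nv xHD))).+1)))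
  _ (fun s' => teval g s' (NLt (nv xHU) (nv xHD)) = false /\ exists f, P f s')); last 2 first.
- by rewrite /=; lia.
- move=> s' _ [bf [f [k [kw k1 hu hd _]]]].
  move: bf; rewrite /= hu hd addn1 ltn_pmul2r // => /negbT; rewrite -leqNgt => wk.
  by exists k, (w - k)%N; split=> //; lia.
rewrite /half_cmd; do 2!apply: run_seqwp => /=.
apply: run_while.
  by exists 0%N; rewrite !subn0 /= /update /= sin.
move=> f s' [k [kw k1 hu hd ->]] ag; rewrite /= hu hd addn1 ltn_pmul2r // => kk.
exists 20%N, ((w - k.+1) * 40)%N; split; last by lia.
apply: run_wp => //=.
have aS : nmem s' xHSTEP 0%N = step by rewrite ag.1.
exists k.+1; rewrite /update /= !aS hu hd; split=> //; try lia.
by rewrite -{2}[step]mul1n -mulnBl; congr (_ * _)%N; lia.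
Qed.

Definition line_at (a b : nat -> R) (Q : nat -> nat) (m i : nat) (c : R) (t : nat) : R :=
  a (Q (t * m + i)%N) - b (Q (t * m + i)%N) * c.

Lemma nest_max_spec s m i L c :
  nmem s 0 0%N = m -> (i < m)%N -> nmem s xMT 0%N = (L * m)%N -> nmem s xQP 0%N = i ->
  rmem s rZZ 0%N = c -> rmem s rYY 0%N = 0 ->
  run g nest_max_loop s (L * 80 + 20) (fun s' => rmem s' rYY 0%N =
    maxto (line_at (rmem s rA) (rmem s rB) (nmem s aQQ) m i c) L).
Proof.
move=> sm im smt sqp sz sy.
set v := line_at _ _ _ _ _ _.
pose P f s' := exists t, [/\ (t <= L)%N, nmem s' xQP 0%N = (t * m + i)%N,
  rmem s' rYY 0%N = maxto v t & f = ((L - t) * 80)%N].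
apply: (@run_imp _ _ _ _ (L * 80 + (tcost (NLt (nv xQP) (nv xMT))).+1) _
  (fun s' => teval g s' (NLt (nv xQP) (nv xMT)) = false /\ exists f, P f s')); last 2 first.
- by rewrite /=; lia.
- move=> s' ag [bf [f [t [tL qp yy _]]]].
  move: bf; rewrite /= qp addn1 ag.1 // smt row_lt // => /negbT; rewrite -leqNgt => Lt.
  by rewrite yy; congr maxto; lia.
apply: run_while; first by exists 0%N; rewrite subn0.
move=> f s' [t [tL qp yy ->]] ag.
have aM : nmem s' xMT 0%N = (L * m)%N by rewrite ag.1.
have am : nmem s' 0 0%N = m by rewrite ag.1.
have aQ : nmem s' aQQ = nmem s aQQ by rewrite ag.1.
have aA : rmem s' rA = rmem s rA by rewrite ag.2.
have aB : rmem s' rB = rmem s rB by rewrite ag.2.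
have aZ : rmem s' rZZ 0%N = c by rewrite ag.2.
rewrite /= qp aM addn1 row_lt // => tL'.
exists 60%N, ((L - t.+1) * 80)%N; split; last by lia.
apply: run_wp => //=.
rewrite yy qp aQ aA aB aZ -/(line_at _ _ _ _ _ _ _) -/v.
case: lerP => h; exists t.+1; split=> //=; rewrite /update /= ?am ?qp ?yy ?aQ ?aA ?aB ?aZ.
- by rewrite mulSn; lia.
- by rewrite -/(line_at _ _ _ _ _ _ _) -/v max_r.
- by rewrite mulSn; lia.
- by rewrite max_l // ltW.
Qed.

Lemma eval_spec s m L c :
  nmem s 0 0%N = m -> nmem s xMT 0%N = (L * m)%N -> rmem s rZZ 0%N = c ->
  run g eval_cmd s ((m * L + m + 1) * 100) (fun s' => rmem s' rFF 0%N =
    \sum_(0 <= i < m) maxto (line_at (rmem s rA) (rmem s rB) (nmem s aQQ) m i c) L).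
Proof.
move=> sm smt sz.
pose F i := maxto (line_at (rmem s rA) (rmem s rB) (nmem s aQQ) m i c) L.
apply: (@run_leq _ _ _ _ (3 + (m * (3 + (4 + (L * 80 + 20 + 10)) + 20) + 20))).
- have -> : (m * (3 + (4 + (L * 80 + 20 + 10)) + 20) = m * L * 80 + m * 57)%N by ring.
  lia.
rewrite /eval_cmd; apply: run_seqwp => /=.
apply: (@run_for _ _ _ _ _ _ m _ (fun k s' => rmem s' rFF 0%N = \sum_(0 <= i < k) F i)) => //.
- by rewrite big_geq.
- by move=> k s' km sk _ ag /=; rewrite ag.1.
move=> k s' km sk ff ag; do 2!apply: run_seqwp => /=.
apply: run_seq.
  apply: (@nest_max_spec _ m k L c) => //=.
  - by rewrite /update /= ag.1.
  - by rewrite /update /= ag.1.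
  - by rewrite /update /= ag.2.
move=> s1 a1 /= yy; apply: run_wp => //=.
rewrite /update /= yy a1.2 //= /update /= ff big_nat_recr //=.
by rewrite !ag.2 // ag.1.
Qed.

Lemma cross_spec s D H :
  nmem s xDD 0%N = D -> nmem s xHH 0%N = H ->
  let Q := nmem s aQQ in
  run g cross_cmd s (D * 80 + 20) (fun s' => forall q, (q < D)%N ->
    nmem s' aPERM q = q /\
    rmem s' rKEY q = (rmem s rA (Q q) - rmem s rA (Q (q + H)%N)) /
                     (rmem s rB (Q q) - rmem s rB (Q (q + H)%N))).
Proof.
move=> sd sh Q.
apply: (@run_leq _ _ _ _ (D * (60 + 20) + 20)).
- lia.
apply: (@run_for _ _ _ _ _ _ D 60 (fun k s' => forall q, (q < k)%N ->
    nmem s' aPERM q = q /\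
    rmem s' rKEY q = (rmem s rA (Q q) - rmem s rA (Q (q + H)%N)) /
                     (rmem s rB (Q q) - rmem s rB (Q (q + H)%N)))) => //.
- by move=> k s' kD sk _ ag /=; rewrite ag.1.
move=> k s' kD sk Pk ag; apply: run_wp => //= q; rewrite ltnS leq_eqVlt.
have aQ : nmem s' aQQ = Q by rewrite ag.1.
have aA : rmem s' rA = rmem s rA by rewrite ag.2.
have aB : rmem s' rB = rmem s rB by rewrite ag.2.
have aH : nmem s' xHH 0%N = H by rewrite ag.1.
rewrite /update /= sk aQ aA aB aH.
by case: eqP => [->|_] //=; exact: Pk.
Qed.

(* [z] is the unknown root; comparing [weight0 * c] with the envelope at [c] is
   the oracle that decides [c <= z]. *)
Lemma search_spec s m L D e z :
  nmem s 0 0%N = m -> nmem s xMT 0%N = (L * m)%N -> nmem s xDD 0%N = D ->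
  (D <= m * L)%N -> (D < 2 ^ e)%N -> 0 <= z ->
  let ck q := rmem s rKEY (nmem s aPERM q) in
  (forall q q', (q <= q')%N -> (q' < D)%N -> ck q <= ck q') ->
  (forall c, (rmem s 0 0%N * c <= \sum_(0 <= i < m)
      maxto (line_at (rmem s rA) (rmem s rB) (nmem s aQQ) m i c) L) = (c <= z)) ->
  run g search_cmd s ((m * L + m + 1) * (e + 1) * 300) (fun s' =>
    rmem s' rTAU 0%N <= z /\
    forall q, (q < D)%N -> ck q <= z -> ck q <= rmem s' rTAU 0%N).
Proof.
move=> sm smt sd DmL De z0 ck srt oracle.
pose P f s' := exists lo hi e',
  [/\ nmem s' xBLO 0%N = lo, nmem s' xBHI 0%N = hi,
      [/\ (lo <= hi)%N, (hi <= D)%N & (hi - lo < 2 ^ e')%N],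
      f = (e' * ((m * L + m + 1) * 250))%N
    & [/\ rmem s' rTAU 0%N <= z, forall q, (q < lo)%N -> ck q <= rmem s' rTAU 0%N
        & forall q, (hi <= q)%N -> (q < D)%N -> z < ck q]].
apply: (@run_imp _ _ _ _ (3 + (3 + (4 + (e * ((m * L + m + 1) * 250)
    + (tcost (NLt (nv xBLO) (nv xBHI))).+1)))) _
  (fun s' => teval g s' (NLt (nv xBLO) (nv xBHI)) = false /\ exists f, P f s')); last 2 first.
- by rewrite /=; nia.
- move=> s' ag [bf [f [lo [hi [e' [slo shi [lh hD _] _ [tz lowq highq]]]]]]].
  move: bf; rewrite /= slo shi addn1 => /negbT; rewrite -leqNgt => hl.
  split=> // q qD qz; apply: lowq; rewrite ltnNge; apply/negP => lq.
  by have := highq q (leq_trans hl lq) qD; rewrite ltNge qz.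
rewrite /search_cmd; do 3!apply: run_seqwp => /=.
apply: run_while.
  exists 0%N, D, e; rewrite /= /update /= subn0; split=> //.
  by split=> // q; rewrite leqNgt => /negbTE ->.
move=> f s' [lo [hi [e' [slo shi [lh hD we] -> [tz lowq highq]]]]] ag.
rewrite /= slo shi addn1 => lh'.
case: e' we => [|e' we]; first by rewrite expn0; lia.
exists ((m * L + m + 1) * 220)%N, (e' * ((m * L + m + 1) * 250))%N.
split; last by rewrite mulSn; lia.
(* Finding the middle by counting takes time linear in [hi - lo <= m * L], which is no more than the
   order of the evaluation that follows. *)
apply: (@run_leq _ _ _ _ (7 + (3 + (((hi - lo) * 40 + 40) + (7 + (6 +
   ((m * L + m + 1) * 100 + 40))))))).
- by lia.
rewrite /search_body; do 2!apply: run_seqwp => /=.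
apply: run_seq.
  by apply: (@half_spec _ (hi - lo) 1) => //=; rewrite /update /= slo shi muln1.
move=> s1 a1 /= [a [b [wE ba ab _ hd]]].
rewrite muln1 in hd.
have fr1 x : x \notin [:: xHIN; xHSTEP; xHU; xHD] -> nmem s1 x = nmem s' x.
  rewrite !inE !negb_or => /and4P[h1 h2 h3 h4].
  rewrite a1.1 /=; first by rewrite !update_other.
  by rewrite !inE !negb_or h3 h4.
have fr x : x \notin [:: xHIN; xHSTEP; xHU; xHD] -> x \notin nwrites search_cmd -> 
    nmem s1 x = nmem s x.
  move=> x1; rewrite fr1 // /= 2!in_cons 2!negb_or => /and3P[h1 h2 h3].
  by rewrite ag.1 //= !update_other.
have rr x : x \notin rwrites search_cmd -> rmem s1 x = rmem s x.
  rewrite /= in_cons negb_or => /andP[h1 h2].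
  by rewrite a1.2 //= ag.2 //= update_other.
do 2!apply: run_seqwp => /=.
set mid := (lo + b)%N.
have midE : (nmem s1 xBLO 0 + nmem s1 xHD 0 = mid)%N by rewrite fr1 // slo hd.
have ckE : rmem s1 rKEY (nmem s1 aPERM mid) = ck mid by rewrite rr // fr.
have midh : (mid < hi)%N by rewrite /mid; lia.
apply: run_seq.
  apply: (@eval_spec _ m L (ck mid)) => /=.
  - by rewrite /update /= fr.
  - by rewrite /update /= fr.
  - by rewrite /update /= midE ckE.
move=> s2 a2 /=; rewrite /update /= fr // !rr // => ff.
have g0 : rmem s2 0 0%N = rmem s 0 0%N by rewrite a2.2 //= /update /= rr.
have gz : rmem s2 rZZ 0%N = ck mid by rewrite a2.2 //= /update /= midE ckE.
have gt : rmem s2 rTAU 0%N = rmem s' rTAU 0%N by rewrite a2.2 //= /update /= a1.2.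
have gm : nmem s2 xBMID 0%N = mid by rewrite a2.1 //= /update /= midE.
have glo : nmem s2 xBLO 0%N = lo by rewrite a2.1 //= /update /= fr1.
have ghi : nmem s2 xBHI 0%N = hi by rewrite a2.1 //= /update /= fr1.
apply: run_wp => //=.
rewrite g0 gz ff oracle.
have P2 : (2 ^ e'.+1 = 2 ^ e' + 2 ^ e')%N by rewrite expnS mul2n addnn.
case: (lerP (ck mid) z) => cz; rewrite /= /update /= ?gt ?gz.
  case: (lerP (rmem s' rTAU 0%N) (ck mid)) => tc; exists mid.+1, hi, e'; rewrite /= gm addn1 ghi;
    split=> //; rewrite ?gt ?gz; try (by split=> //; rewrite /mid; lia); split=> //.
  - by move=> q qm; apply: srt => //; exact: leq_trans hD.
  - move=> q qm; apply: le_trans (ltW tc); apply: srt => //; exact: leq_trans hD.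
exists lo, mid, e'; rewrite /= gm glo gt; split=> //.
  by split; rewrite /mid; lia.
split=> // q mq qD; apply: lt_le_trans cz _; exact: srt.
Qed.

Lemma resolve_spec s D H z :
  nmem s xDD 0%N = D -> nmem s xHH 0%N = H -> (D <= H)%N ->
  let Q := nmem s aQQ in
  let a := rmem s rA in let b := rmem s rB in
  (forall q, (q < D)%N -> rmem s rKEY q =
     (a (Q q) - a (Q (q + H)%N)) / (b (Q q) - b (Q (q + H)%N))) ->
  rmem s rTAU 0%N <= z ->
  (forall q, (q < D)%N -> rmem s rKEY q <= z -> rmem s rKEY q <= rmem s rTAU 0%N) ->
  run g resolve_cmd s (D * 120 + 20) (fun s' =>
    (forall q, (q < D)%N ->
      [/\ nmem s' aQQ q = Q q \/ nmem s' aQQ q = Q (q + H)%N,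
          a (Q q) - b (Q q) * z <= a (nmem s' aQQ q) - b (nmem s' aQQ q) * z
        & a (Q (q + H)%N) - b (Q (q + H)%N) * z <=
          a (nmem s' aQQ q) - b (nmem s' aQQ q) * z]) /\
    (forall q, (D <= q)%N -> nmem s' aQQ q = Q q)).
Proof.
move=> sd sh DH Q a b ck tz near.
pose better q p := [/\ p = Q q \/ p = Q (q + H)%N, a (Q q) - b (Q q) * z <= a p - b p * z
  & a (Q (q + H)%N) - b (Q (q + H)%N) * z <= a p - b p * z].
apply: (@run_imp _ _ _ _ (D * (100 + 20) + 20) _ (fun s' =>
    (forall q, (q < D)%N -> better q (nmem s' aQQ q)) /\
    (forall q, (D <= q)%N -> nmem s' aQQ q = Q q))); last 2 first.
- lia.
- by [].
apply: (@run_for _ _ _ _ _ _ D 100 (fun k s' =>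
    (forall q, (q < k)%N -> better q (nmem s' aQQ q)) /\
    (forall q, (k <= q)%N -> nmem s' aQQ q = Q q))) => //.
- by move=> k s' kD sk _ ag /=; rewrite ag.1.
move=> k s' kD sk [done todo] ag; apply: run_wp => //=.
have aA : rmem s' rA = a by rewrite ag.2.
have aB : rmem s' rB = b by rewrite ag.2.
have aK : rmem s' rKEY k = (a (Q k) - a (Q (k + H)%N)) / (b (Q k) - b (Q (k + H)%N)).
  by rewrite ag.2 // ck.
have aT : rmem s' rTAU 0%N = rmem s rTAU 0%N by rewrite ag.2.
have aH : nmem s' xHH 0%N = H by rewrite ag.1.
rewrite /update /= sk aA aB aH aT !(todo k) // !(todo (k + H)%N) ?leq_addr //.
have tauE : (rmem s' rKEY k <= rmem s rTAU 0%N) = (rmem s' rKEY k <= z).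
  have kE : rmem s' rKEY k = rmem s rKEY k by rewrite ag.2.
  rewrite kE; apply/idP/idP => [h|]; [exact: le_trans h tz|exact: near].
rewrite tauE aK.
set da := a (Q k) - _; set db := b (Q k) - _.
have keep : better k (Q k) ->
    (forall q, (q < k.+1)%N -> better q (nmem s' aQQ q)) /\
    (forall q, (k < q)%N -> nmem s' aQQ q = Q q).
  move=> bk; split=> q; last by move/ltnW; exact: todo.
  by rewrite ltnS leq_eqVlt => /orP[/eqP ->|/done //]; rewrite todo.
have change : better k (Q (k + H)%N) ->
    (forall q, (q < k.+1)%N -> better q (if q == k then Q (k + H)%N else nmem s' aQQ q)) /\
    (forall q, (k < q)%N -> (if q == k then Q (k + H)%N else nmem s' aQQ q) = Q q).
  move=> bk; split=> q.
    by rewrite ltnS leq_eqVlt; case: eqP => [->|_] //=; exact: done.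
  by case: eqP => [->|_ /ltnW]; [rewrite ltnn|exact: todo].
have better1 : db * z <= da -> better k (Q k).
  by move=> h; split; [left|exact: lexx|move: h; rewrite /da /db; lra].
have better2 : da <= db * z -> better k (Q (k + H)%N).
  by move=> h; split; [right|move: h; rewrite /da /db; lra|exact: lexx].
case: (lerP db 0) => b0; last first.
  case: ifP => h; rewrite /= ?sk ?aH ?(todo (k + H)%N) ?leq_addr //.
    by apply: change; apply: better2; move: h; rewrite ler_pdivrMr // mulrC.
  apply: keep; apply: better1; move/negbT: h; rewrite -ltNge ltr_pdivlMr // mulrC.
  exact: ltW.
case: (lerP 0 db) => b1.
  have db0 : db = 0 by apply/eqP; rewrite eq_le b0 b1.
  case: (lerP da 0) => h; rewrite /= ?sk ?aH ?(todo (k + H)%N) ?leq_addr //.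
    by apply: change; apply: better2; rewrite db0 mul0r.
  by apply: keep; apply: better1; rewrite db0 mul0r ltW.
case: ifP => h; rewrite /= ?sk ?aH ?(todo (k + H)%N) ?leq_addr //.
  by apply: keep; apply: better1; move: h; rewrite ler_ndivrMr // mulrC.
apply: change; apply: better2; move/negbT: h; rewrite -ltNge ltr_ndivlMr // mulrC.
exact: ltW.
Qed.

End Rounds.

(** * Correctness and cost of the tournament *)

Section RoundsCorrect.

Variables (R : realType) (m n : nat) (I : instance R m n).
Variables (L0 : nat) (a b : nat -> R) (z : R) (f : 'I_m -> R).
Hypothesis snd : lines_sound I L0 a b.
Hypothesis root : envelope_root I L0 a b z f.
Let g := exponents I.
Implicit Types s : memory R.

(** Away from the root the envelope of the remaining lines may drop. What is preserved is that they
    are lines of the same nest and that one of them attains the height [f i] at [z]. *)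
Definition surviving (L : nat) (Q : nat -> nat) : Prop :=
  (forall (i : 'I_m) t, (t < L)%N ->
     exists2 t', (t' < L0)%N & Q (t * m + i)%N = (t' * m + i)%N) /\
  (forall i : 'I_m, exists2 t, (t < L)%N & line_at a b Q m i z t = f i).

(** Both sides agree at [z]. The left one increases strictly with [c], while the envelopes do not
    increase, as all lines have slope -b <= 0; so the oracle stays correct after lines have been
    dropped. *)
Lemma surviving_oracle L Q c : surviving L Q ->
  (weight0 I * c <= \sum_(0 <= i < m) maxto (line_at a b Q m i c) L) = (c <= z).
Proof.
move=> [rows ex]; have [z0 _ sumf env] := root.
have b0 (i : 'I_m) t : (t < L)%N -> 0 <= b (Q (t * m + i)%N).
  move=> tL; have [t' t'L ->] := rows i t tL.
  by have [S [_ _ ->]] := snd i t'L; exact: line_b_ge0.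
have lef (i : 'I_m) t : (t < L)%N -> line_at a b Q m i z t <= f i.
  move=> tL; rewrite /line_at; have [t' t'L ->] := rows i t tL.
  by have [_ _] := env i; apply.
rewrite big_mkord; case: (leP c z) => cz.
  apply: (@le_trans _ _ (weight0 I * z)).
    by apply: ler_wpM2l => //; exact: ltW (weight0_gt0 I).
  rewrite -sumf; apply: ler_sum => i _.
  have [t tL <-] := ex i; apply: le_trans (maxto_ge _ tL).
  by rewrite /line_at lerD2l lerN2; apply: ler_wpM2l; [exact: b0|].
apply/negbTE; rewrite -ltNge.
apply: (@le_lt_trans _ _ (weight0 I * z)); last by rewrite ltr_pM2l ?weight0_gt0.
rewrite -sumf; apply: ler_sum => i _.
have [f0 _ _] := env i; apply: maxto_le => // t tL.
apply: le_trans (lef i t tL).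
by rewrite /line_at lerD2l lerN2; apply: ler_wpM2l; [exact: b0|exact: ltW].
Qed.

(** The winner of a pair is at [z] no lower than either member, and as a line of the nest it is at
    most [f i] there. So if one member attains [f i], the winner does. For odd [u + v] the row [v]
    has no partner and is kept. *)
Lemma surviving_halve u v Q Q' :
  (v <= u)%N -> (0 < u)%N -> surviving (u + v) Q ->
  (forall q, (q < v * m)%N ->
    [/\ Q' q = Q q \/ Q' q = Q (q + u * m)%N,
        a (Q q) - b (Q q) * z <= a (Q' q) - b (Q' q) * z
      & a (Q (q + u * m)%N) - b (Q (q + u * m)%N) * z <= a (Q' q) - b (Q' q) * z]) ->
  (forall q, (v * m <= q)%N -> Q' q = Q q) ->
  surviving u Q'.
Proof.
move=> vu u0 [rows ex] best same.
have pos t (i : 'I_m) : (t * m + i + u * m = (t + u) * m + i)%N by rewrite mulnDl; lia.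
have rows' (i : 'I_m) t : (t < u)%N ->
    exists2 t', (t' < L0)%N & Q' (t * m + i)%N = (t' * m + i)%N.
  move=> tu; case: (ltnP (t * m + i) (v * m)) => h.
    have tv : (t < v)%N by rewrite -(@row_lt m i).
    have [[->|->] _ _] := best _ h; first by apply: rows; lia.
    by rewrite pos; apply: rows; lia.
  by rewrite same //; apply: rows; lia.
split=> // i; have [t tL vt] := ex i.
have [_ _ env] : [/\ 0 <= f i, exists2 t, (t < L0)%N & a (t * m + i)%N - b (t * m + i)%N * z = f i
      & forall t, (t < L0)%N -> a (t * m + i)%N - b (t * m + i)%N * z <= f i].
  by case: root => _ _ _; apply.
have le' t' : (t' < u)%N -> line_at a b Q' m i z t' <= f i.
  by move=> t'u; rewrite /line_at; have [t2 t2L ->] := rows' i t' t'u; exact: env.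
case: (ltnP t u) => tu; last first.
  have h : ((t - u) * m + i < v * m)%N by rewrite row_lt //; lia.
  have tu' : (t - u < u)%N by lia.
  exists (t - u)%N => //; apply/eqP; rewrite eq_le le' //= -vt /line_at.
  have [_ _] := best _ h; rewrite pos.
  by have -> : (t - u + u = t)%N by lia.
exists t => //; case: (ltnP (t * m + i) (v * m)) => h; last by rewrite /line_at same.
by apply/eqP; rewrite eq_le le' //= -vt /line_at; have [] := best _ h.
Qed.

(** The new number of lines is the upper half of [L]. The bound [3 * L' <= 2 * L + 1] states the
    shrinking linearly and covers L = 3, where only one third disappears. *)
Lemma round_spec s L e :
  nmem s 0 0%N = m -> rmem s 0 0%N = weight0 I -> rmem s rA = a -> rmem s rB = b ->
  nmem s xMT 0%N = (L * m)%N -> (1 < L)%N -> (0 < m)%N -> (L * m < 2 ^ e)%N ->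
  surviving L (nmem s aQQ) ->
  run g round_cmd s (m * L * (e + 1) * 2500) (fun s' => exists L',
    [/\ nmem s' xMT 0%N = (L' * m)%N, (0 < L')%N, (3 * L' <= 2 * L + 1)%N
      & surviving L' (nmem s' aQQ)]).
Proof.
move=> sm sw sA sB sMT L1 m0 Le srv.
have [z0 _ _ _] := root.
have mL : (0 < m * L)%N by rewrite muln_gt0 m0 /=; lia.
apply: (@run_leq _ _ _ _ (4 + (4 + ((L * 40 + 40) + (4 + (4 + (((m * L) * 80 + 20)
   + (4 + ((m * L + 1) * (e + 1) * 500 + ((m * L + m + 1) * (e + 1) * 300
   + (((m * L) * 120 + 20) + 4))))))))))).
- have h1 : (L <= m * L)%N by rewrite leq_pmull.
  have h2 : (m <= m * L)%N by rewrite leq_pmulr //; lia.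
  have h3 : (m * L <= m * L * (e + 1))%N by rewrite leq_pmulr // addn1.
  have h4 : ((m * L + 1) * (e + 1) <= (m * L * (e + 1)) * 2)%N by nia.
  have h5 : ((m * L + m + 1) * (e + 1) <= (m * L * (e + 1)) * 3)%N by nia.
  lia.
rewrite /round_cmd; do 2!apply: run_seqwp => /=.
apply: run_seq.
  apply: (@half_spec _ _ _ L m) => //=; by rewrite /update /= ?sMT ?sm.
move=> s1 a1 /= [u [v [LE vu uv hu hd]]].
have u0 : (0 < u)%N by lia.
have vmL : (v * m <= m * L)%N by rewrite mulnC leq_mul2l LE leq_addl orbT.
do 2!apply: run_seqwp => /=.
set s2 := Memory _ _.
have n2 x : x \notin [:: xHIN; xHSTEP; xHU; xHD; xDD; xHH] -> nmem s2 x = nmem s x.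
  rewrite !inE !negb_or => /and5P[h1 h2 h3 h4 /andP[h5 h6]].
  rewrite /s2 /= !update_other // a1.1 /= ?update_other //.
  by rewrite !inE !negb_or h3 h4.
have r2 x : rmem s2 x = rmem s x by rewrite /s2 /= a1.2.
have sD2 : nmem s2 xDD 0%N = (v * m)%N by rewrite /s2 /= /update /= hd.
have sH2 : nmem s2 xHH 0%N = (u * m)%N by rewrite /s2 /= /update /= hu.
apply: run_seq.
  apply: (run_leq _ (cross_spec g sD2 sH2)).
  by rewrite leq_add2r leq_mul2r vmL orbT.
move=> s3 a3 ck; rewrite !r2 n2 // sA sB in ck.
apply: run_seqwp => /=; set s4 := nput _ _ _ _.
have n4 x : x != xNUM -> nmem s4 x = nmem s3 x by move=> xN; rewrite /s4 /= update_other.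
have De : (v * m < 2 ^ e)%N by apply: leq_ltn_trans Le; rewrite (mulnC L).
apply: run_seq.
  apply: (run_leq _ (@sort_spec _ g s4 (v * m) e _ (ltnW De))).
  - by rewrite leq_mul2r leq_mul2r !leq_add2r vmL !orbT.
  - by rewrite /s4 /= /update /= a3.1 // sD2.
move=> s5 a5 [srt prm].
rewrite n4 // in prm.
have P0 : sub (nmem s3 aPERM) 0 (v * m) = iota 0 (v * m).
  rewrite -[RHS]map_id /sub subn0; apply/eq_in_map => k.
  by rewrite mem_iota => kn; have [] := ck k kn.
rewrite P0 in prm.
have k5 : rmem s5 rKEY = rmem s3 rKEY by rewrite a5.2.
have n5 x : x \notin nwrites sort_cmd -> x != xNUM -> x \notin nwrites cross_cmd ->
    nmem s5 x = nmem s2 x.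
  by move=> x1 x2 x3; rewrite a5.1 // n4 // a3.1.
have r5 x : x != rKEY -> rmem s5 x = rmem s x.
  by move=> xK; rewrite a5.2 // a3.2 ?r2 // /= inE.
have q5 : nmem s5 aQQ = nmem s aQQ by rewrite n5 // n2.
have key5 q : (q < v * m)%N -> rmem s5 rKEY q =
    (a (nmem s aQQ q) - a (nmem s aQQ (q + u * m)%N)) /
    (b (nmem s aQQ q) - b (nmem s aQQ (q + u * m)%N)).
  by move=> qD; rewrite k5; have [] := ck q qD.
apply: run_seq.
  apply: (@search_spec _ g s5 m L (v * m) e z) => //.
  - by rewrite n5 // n2.
  - by rewrite n5 // n2.
  - by rewrite n5.
  - move=> q q' qq' qD; rewrite k5; exact: (sorted_key_le srt).
  - by move=> c; rewrite !r5 // sA sB q5 sw; exact: surviving_oracle.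
move=> s6 a6 [tz near].
have A6 : rmem s6 rA = a by rewrite a6.2 // r5.
have B6 : rmem s6 rB = b by rewrite a6.2 // r5.
have q6 : nmem s6 aQQ = nmem s aQQ by rewrite a6.1.
(* [near] speaks of positions in the sorted order; the permutation carries it over to every pair. *)
have near' q : (q < v * m)%N -> rmem s5 rKEY q <= z -> rmem s5 rKEY q <= rmem s6 rTAU 0%N.
  move=> qD; have : q \in sub (nmem s5 aPERM) 0 (v * m).
    by rewrite (perm_mem prm) mem_iota.
  by move=> /mapP[q0]; rewrite subn0 mem_iota => /andP[_ q0D] ->; exact: near.
apply: run_seq.
  apply: (@run_leq _ _ _ _ ((v * m) * 120 + 20)).
  - by rewrite leq_add2r leq_mul2r vmL orbT.
  apply: (@resolve_spec _ g s6 (v * m) (u * m) z) => //.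
  - by rewrite a6.1 // n5.
  - by rewrite a6.1 // n5.
  - by rewrite leq_mul2r vu orbT.
  - by move=> q qD; rewrite A6 B6 q6 a6.2 //; exact: key5.
  - move=> q qD; rewrite a6.2 //; exact: near'.
move=> s7 a7; rewrite A6 B6 q6 => -[best same].
apply: run_wp => //=; exists u; rewrite /update /=; split=> //.
- by rewrite a7.1 // a6.1 // n5.
- lia.
- by apply: (surviving_halve vu u0 _ best same); rewrite -LE.
Qed.

Lemma rounds_spec s e :
  nmem s 0 0%N = m -> rmem s 0 0%N = weight0 I -> rmem s rA = a -> rmem s rB = b ->
  nmem s xMT 0%N = (L0 * m)%N -> (0 < L0)%N -> (0 < m)%N -> (L0 * m < 2 ^ e)%N ->
  (forall (i : 'I_m) t, (t < L0)%N -> nmem s aQQ (t * m + i)%N = (t * m + i)%N) ->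
  run g rounds_cmd s (m * L0 * (e + 1) * (4000 * 5) + 20) (fun s' => forall i : 'I_m,
    exists2 t, (t < L0)%N & nmem s' aQQ i = (t * m + i)%N /\
      a (t * m + i)%N - b (t * m + i)%N * z = f i).
Proof.
move=> sm sw sA sB sMT L00 m0 Le ids.
pose P k s' := exists L, [/\ nmem s' xMT 0%N = (L * m)%N, (0 < L)%N, (L <= L0)%N,
  surviving L (nmem s' aQQ) & k = (m * L * (e + 1) * (4000 * 5))%N].
apply: (@run_imp _ _ _ _ (m * L0 * (e + 1) * (4000 * 5) + (tcost (NLt (nv 0) (nv xMT))).+1) _
  (fun s' => teval g s' (NLt (nv 0) (nv xMT)) = false /\ exists k, P k s')); last 2 first.
- by rewrite /=; lia.
- move=> s' ag [bf [k [L [mt L_gt0 _ [rows ex] _]]]] i.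
  move: bf; rewrite /= mt addn1 ag.1 // sm -{1}[m]mul1n ltn_pmul2r // => /negbT.
  rewrite -leqNgt => L_le1; have LE : L = 1%N by lia.
  have [t tL vt] := ex i; have [t' t'L Qt] := rows i t tL.
  have t0 : t = 0%N by lia.
  subst t; exists t' => //; move: Qt vt; rewrite /line_at mul0n add0n => -> vt.
  by split.
apply: run_while.
  exists L0; split=> //; split.
    by move=> i t tL; exists t => //; exact: ids.
  move=> i; have [_ _ _ /(_ i)[_ [t tL vt] _]] := root.
  by exists t => //; rewrite /line_at ids.
move=> k s' [L [mt L_gt0 LL0 srv ->]] ag.
rewrite /= mt addn1 ag.1 // sm -{1}[m]mul1n ltn_pmul2r // => L1.
have sm' : nmem s' 0 0%N = m by rewrite ag.1.
have sw' : rmem s' 0 0%N = weight0 I by rewrite ag.2.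
have sA' : rmem s' rA = a by rewrite ag.2.
have sB' : rmem s' rB = b by rewrite ag.2.
have Le' : (L * m < 2 ^ e)%N by apply: leq_ltn_trans Le; rewrite leq_mul2r LL0 orbT.
have [t [s2 [ex tT [L' [mt' L'0 L'L srv']]]]] :=
  round_spec sm' sw' sA' sB' mt L1 m0 Le' srv.
have m1 : (0 < m * (e + 1))%N by rewrite muln_gt0 m0 addn1.
(* The potential is 20000 per line and unit of e + 1. For L >= 2 at least (L - 1)/3 >= L/6 lines of
   each nest vanish, which releases more than 3300 for each of the L lines; the round needs 2500 and
   the test a constant. *)
exists (m * L * (e + 1) * 2500)%N, (m * L' * (e + 1) * (4000 * 5))%N; split.
  exists t, s2; split=> //; exists L'; split=> //; lia.
have E x : (m * x * (e + 1) = x * (m * (e + 1)))%N by ring.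
rewrite !E; move: (m * (e + 1))%N m1 => M M0.
have h : (3 * (L' * M) <= 2 * (L * M) + M)%N.
  by rewrite !mulnA -[X in (_ <= _ + X)%N]mul1n -mulnDl leq_mul2r L'L orbT.
have h2 : (2 * M <= L * M)%N by rewrite leq_mul2r L1 orbT.
rewrite /=; move: (L' * M)%N (L * M)%N h h2 => x y; lia.
Qed.

End RoundsCorrect.

(** * The program *)

Notation rSA := 17%N (only parsing).
Notation rSB := 18%N (only parsing).

(** The root has only been compared with, never computed. Its value is obtained as the expected
    revenue of the surviving lines. *)
Definition value_cmd : cmd :=
  rset rSA RZero ;;
  rset rSB RZero ;;
  For xI (nv 0)
    (rset rSA (RAdd (rv rSA) (RGet rA (NGet aQQ (nv xI)))) ;;
     rset rSB (RAdd (rv rSB) (RGet rB (NGet aQQ (nv xI))))) ;;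
  rset 4 (RDiv (rv rSA) (RAdd (rv 0) (rv rSB))).

Definition write_nest_cmd : cmd :=
  For xK (nv 1)
    (If (NLe (nv xJ) (nv 1))
      (If (RLe (RGet rKEY (nv xK)) (RGet rU (NGet aQQ (nv xI))))
        (NSet 3 (NAdd (nv xBASE) (nv xK)) (NGet aPOST (nv xK)))
        (NSet 3 (NAdd (nv xBASE) (nv xK)) (NGet aPRE (nv xK))))
      (NSet 3 (NAdd (nv xBASE) (nv xK)) (NConst 0))).

(** Each winning set is decoded from its pair (j, u) in O(n) by recomputing the keys and the two
    predicates of line j. The keys are the same real numbers as in the sweep, so the comparison with
    u has the same outcome. *)
Definition write_cmd : cmd :=
  nset xBASE (NConst 0) ;;
  For xI (nv 0)
    (load_cmd ;;
     nset xJ (NGet aJJ (NGet aQQ (nv xI))) ;;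
     keys_cmd ;;
     write_nest_cmd ;;
     nset xBASE (NAdd (nv xBASE) (nv 1))).

Definition assortment_program : cmd :=
  lines_cmd ;; rounds_cmd ;; value_cmd ;; write_cmd.

Section Output.

Variables (R : realType) (m n : nat) (I : instance R m n).
Let g := exponents I.
Implicit Types s : memory R.

Lemma value_spec s :
  nmem s 0 0%N = m ->
  run g value_cmd s (m * 100 + 100) (fun s' => rmem s' 4 0%N =
    (\sum_(i < m) rmem s rA (nmem s aQQ i)) /
    (rmem s 0 0%N + \sum_(i < m) rmem s rB (nmem s aQQ i))).
Proof.
move=> sm.
apply: (@run_leq _ _ _ _ (3 + (3 + ((m * (60 + 20) + 20) + 40)))); first lia.
rewrite /value_cmd; do 2!apply: run_seqwp => /=.
apply: run_seq.
  apply: (@run_for _ _ _ _ _ _ m 60 (fun k s' =>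
    rmem s' rSA 0%N = \sum_(0 <= i < k) rmem s rA (nmem s aQQ i) /\
    rmem s' rSB 0%N = \sum_(0 <= i < k) rmem s rB (nmem s aQQ i))) => //.
  - by rewrite !big_geq.
  - by move=> k s' km sk _ ag /=; rewrite ag.1.
  move=> k s' km sk [sa sb] ag; apply: run_wp => //=.
  have aA : rmem s' rA = rmem s rA by rewrite ag.2.
  have aB : rmem s' rB = rmem s rB by rewrite ag.2.
  have aQ : nmem s' aQQ = nmem s aQQ by rewrite ag.1.
  by rewrite /update /= sa sb sk aA aB aQ !big_nat_recr.
move=> s1 a1 [sa sb]; apply: run_wp => //=.
by rewrite /update /= sa sb !big_mkord a1.2.
Qed.

Lemma write_nest_spec s j base :
  nmem s 1 0%N = n -> nmem s xJ 0%N = j -> nmem s xBASE 0%N = base ->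
  let u := rmem s rU (nmem s aQQ (nmem s xI 0%N)) in
  run g write_nest_cmd s ((n + 1) * 80) (fun s' =>
    (forall k, (k < n)%N -> nmem s' 3 (base + k)%N =
      if (j <= n)%N then
        if rmem s rKEY k <= u then nmem s aPOST k else nmem s aPRE k
      else 0%N) /\
    forall p, (p < base)%N -> nmem s' 3 p = nmem s 3 p).
Proof.
move=> sn sj sb u.
apply: (@run_leq _ _ _ _ (n * (60 + 20) + 20)); first lia.
apply: (@run_for _ _ _ _ _ _ n 60 (fun l s' =>
    (forall k, (k < l)%N -> nmem s' 3 (base + k)%N =
      if (j <= n)%N then
        if rmem s rKEY k <= u then nmem s aPOST k else nmem s aPRE k
      else 0%N) /\
    forall p, (p < base)%N -> nmem s' 3 p = nmem s 3 p)) => //.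
- by move=> k s' kn sk _ ag /=; rewrite ag.1.
move=> l s' ln sl [new old] ag; apply: run_wp => //=.
have aJ : nmem s' xJ 0%N = j by rewrite ag.1.
have an : nmem s' 1 0%N = n by rewrite ag.1.
have ab : nmem s' xBASE 0%N = base by rewrite ag.1.
have aI : nmem s' xI 0%N = nmem s xI 0%N by rewrite ag.1.
have aQ : nmem s' aQQ = nmem s aQQ by rewrite ag.1.
have aPo : nmem s' aPOST = nmem s aPOST by rewrite ag.1.
have aPr : nmem s' aPRE = nmem s aPRE by rewrite ag.1.
have aU : rmem s' rU = rmem s rU by rewrite ag.2.
have aK : rmem s' rKEY = rmem s rKEY by rewrite ag.2.
have upd v : v = (if (j <= n)%N then
        if rmem s rKEY l <= u then nmem s aPOST l else nmem s aPRE l else 0%N) ->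
    (forall k, (k < l.+1)%N -> (if (base + k == base + l)%N then v else nmem s' 3 (base + k)%N) =
      if (j <= n)%N then
        if rmem s rKEY k <= u then nmem s aPOST k else nmem s aPRE k
      else 0%N) /\
    forall p, (p < base)%N -> (if (p == base + l)%N then v else nmem s' 3 p) = nmem s 3 p.
  move=> ->; split=> [k|p pb]; last by case: eqP => [|_]; [lia|exact: old].
  by rewrite ltnS eqn_add2l leq_eqVlt; case: eqP => [->|_] //=; exact: new.
rewrite /update /= aJ an aI aQ aU aK sl -/u.
case: ifP => jn; last by rewrite /= ?ab ?sl; apply: upd; rewrite jn.
by case: ifP => ku; rewrite /= ?ab ?sl ?aPo ?aPr; apply: upd; rewrite jn ku.
Qed.

Lemma write_spec s : input I s ->
  run g write_cmd s (m * ((n + 1) * 500) + 100) (fun s' => forall (i : 'I_m) (k : 'I_n),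
    nmem s' 3 (i * n + k)%N =
    (k \in coded_set I i (nmem s aJJ (nmem s aQQ i)) (rmem s rU (nmem s aQQ i))) :> nat).
Proof.
move=> [[sm sn] sC [sv0 sd] sw sr].
apply: (@run_leq _ _ _ _ (3 + (m * (((n + 1) * 100 + (6 + ((n + 1) * 200 +
   ((n + 1) * 80 + 10)))) + 20) + 20))); first nia.
rewrite /write_cmd; apply: run_seqwp => /=.
pose J i := nmem s aJJ (nmem s aQQ i); pose U i := rmem s rU (nmem s aQQ i).
pose Inv l s' := nmem s' xBASE 0%N = (l * n)%N /\ forall (i : 'I_m) (k : 'I_n), (i < l)%N ->
    nmem s' 3 (i * n + k)%N = (k \in coded_set I i (J i) (U i)).
apply: (@run_imp _ _ _ _ (m * (((n + 1) * 100 + (6 + ((n + 1) * 200 +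
   ((n + 1) * 80 + 10)))) + 20) + 20) _ (Inv m)); last 2 first.
- by [].
- by move=> s' _ [_ H] i k; exact: H.
apply: (@run_for _ _ _ _ _ _ m _ Inv) => //.
- by move=> l s' lm sl _ ag /=; rewrite ag.1.
move=> l s' lm sl [sb done] ag.
have w2 : rmem s' 2 = rmem s 2 by rewrite ag.2.
have w3 : rmem s' 3 = rmem s 3 by rewrite ag.2.
have wn : nmem s' 1 0%N = n by rewrite ag.1.
have wJ : nmem s' aJJ = nmem s aJJ by rewrite ag.1.
have wQ : nmem s' aQQ = nmem s aQQ by rewrite ag.1.
have wU : rmem s' rU = rmem s rU by rewrite ag.2.
set i := Ordinal lm.
apply: run_seq.
  apply: (@load_spec _ _ _ n (i * n) (item_weight I i) (item_value I i)) => //.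
  - by move=> k kn; rewrite w2 (sw i (Ordinal kn)) (item_weight_ord I i (Ordinal kn)).
  - move=> k kn; rewrite w2 w3 (sw i (Ordinal kn)) (sr i (Ordinal kn)).
    by rewrite (item_value_ord I i (Ordinal kn)).
  - exact: item_weight_dummy.
  - exact: item_value_dummy.
move=> s1 a1 sxy; apply: run_seqwp => /=.
set s2 := Memory _ _.
have n2 x : x != xJ -> nmem s2 x = nmem s1 x by move=> xN; rewrite /s2 /= update_other.
have j2 : nmem s2 xJ 0%N = J l.
  by rewrite /s2 /= /update /= !a1.1 // wJ wQ sl.
apply: run_seq.
  by apply: (keys_spec g _ j2); rewrite n2 // a1.1.
move=> s3 a3 kd.
have s3n : nmem s3 1 0%N = n by rewrite a3.1 // n2 // a1.1.
have s3j : nmem s3 xJ 0%N = J l by rewrite a3.1.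
have s3b : nmem s3 xBASE 0%N = (l * n)%N by rewrite a3.1 // n2 // a1.1.
apply: run_seq; first exact: (write_nest_spec s3n s3j s3b).
move=> s4 a4 [new old].
have uE : rmem s3 rU (nmem s3 aQQ (nmem s3 xI 0%N)) = U l.
  rewrite a3.2 // /s2 /= a1.2 // wU; congr (rmem s rU _).
  by rewrite !a3.1 // !n2 // !a1.1 // wQ sl.
rewrite uE in new.
apply: run_wp => //=; split.
  by rewrite /= /update /= !a4.1 // s3b s3n mulSnr.
move=> i' k; rewrite ltnS leq_eqVlt /= /update /= => /orP[/eqP i'l|i'l].
  have -> : i' = i by exact: val_inj.
  rewrite /= new // /coded_set /=; case: ifP => jn; last by rewrite inE.
  have [-> _ -> ->] := kd k (ltnW (ltn_ord k)).
  have sxy' x : (x <= n)%N -> rmem s2 rX x = item_weight I i x /\ rmem s2 rY x = item_value I i x.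
    exact: sxy.
  rewrite (key_ext sxy') // (pre_ext sxy') // (post_ext sxy') //.
  by rewrite inE /cand; case: ifP.
rewrite old; last first.
  by apply: (@leq_trans (i'.+1 * n)); [rewrite mulSnr ltn_add2l|rewrite leq_mul2r i'l orbT].
rewrite a3.1 // n2 // a1.1 //; exact: done.
Qed.

End Output.

(** The logarithm enters as any natural number [e] with enough powers of 2, which keeps the cost
    analysis within [nat]. *)
Lemma program_solves : exists K, forall (R : realType) (m n : nat) (I : instance R m n)
    (s : memory R) e,
  (0 < m)%N -> input I s -> (n.+1 * n.+1 * m < 2 ^ e)%N ->
  exists2 t, solves_in I assortment_program s t &
    (t <= m * (n + 1) * (n + 1) * (e + 1) * K)%N.
Proof.
exists (4000 * 7)%N => R m n I s e m0 inp Le; have [[sm sn] sC [sv0 sd] sw sr] := inp.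
have ne : (n.+1 <= 2 ^ e)%N.
  apply: ltnW; apply: leq_ltn_trans Le; rewrite -mulnA leq_pmulr // muln_gt0 //.
set g := exponents I.
have H : run g assortment_program s (m * (n + 1) * (n + 1) * (e + 1) * (4000 * 7)) (fun s' =>
    is_max_revenue I (output_value s') /\
    exists2 S : assortment m n, output_assortment s' S & optimal I S).
  apply: (@run_leq _ _ _ _ (m * (n + 1) * (n + 1) * (e + 1) * 4000 +
     ((m * (n.+1 * n.+1) * (e + 1) * (4000 * 5) + 20) +
      ((m * 100 + 100) + (m * ((n + 1) * 500) + 100))))).
    have h1 : (m * (n + 1) <= m * (n + 1) * (n + 1) * (e + 1))%N.
      by rewrite -mulnA leq_pmulr // muln_gt0 !addn1.
    have h2 : (m <= m * (n + 1))%N by rewrite leq_pmulr // addn1.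
    rewrite -(addn1 n).
    have -> : (m * ((n + 1) * (n + 1)) * (e + 1) = m * (n + 1) * (n + 1) * (e + 1))%N by ring.
    have -> : (m * ((n + 1) * 500) = m * (n + 1) * 500)%N by ring.
    lia.
  rewrite /assortment_program; apply: run_seq; first exact: (lines_spec inp m0 ne).
  move=> s1 a1 [mt snd lsnd lcpl].
  have [z [f root]] := envelope_root_exists lsnd lcpl.
  have m1 : nmem s1 0 0%N = m by rewrite a1.1.
  have w1 : rmem s1 0 0%N = weight0 I by rewrite a1.2.
  apply: run_seq.
    apply: (rounds_spec lsnd root m1 w1 (erefl _) (erefl _) mt _ m0 Le) => //.
    by move=> i t tL; have [] := snd i t tL.
  move=> s2 a2 best; apply: run_seq.
    by apply: (@value_spec _ _ _ I); rewrite a2.1.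
  move=> s3 a3 val3.
  have inp3 : input I s3.
    by split; rewrite ?a3.1 // ?a3.2 // ?a2.1 // ?a2.2 // ?a1.1 // ?a1.2.
  apply: (run_imp (write_spec inp3)) => // s4 a4 out.
  have [z0 mx sumf env] := root.
  pose S : assortment m n := [ffun i =>
    coded_set I i (nmem s3 aJJ (nmem s3 aQQ i)) (rmem s3 rU (nmem s3 aQQ i))].
  have q3 : nmem s3 aQQ = nmem s2 aQQ by rewrite a3.1.
  have J3 : nmem s3 aJJ = nmem s1 aJJ by rewrite a3.1 // a2.1.
  have U3 : rmem s3 rU = rmem s1 rU by rewrite a3.2 // a2.2.
  have A2 : rmem s2 rA = rmem s1 rA by rewrite a2.2.
  have B2 : rmem s2 rB = rmem s1 rB by rewrite a2.2.
  have SE i : [/\ (#|S i| <= capacity I i)%N,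
      rmem s2 rA (nmem s2 aQQ i) = line_a I i (S i),
      rmem s2 rB (nmem s2 aQQ i) = line_b I i (S i)
    & line_a I i (S i) - line_b I i (S i) * z = f i].
    have [t tL [Qi fi]] := best i; have [_ c ea eb] := snd i t tL.
    rewrite ffunE q3 Qi J3 U3 A2 B2.
    by split=> //; rewrite -ea -eb.
  (* The heights [f i] of the surviving lines add up to [weight0 I * z], so the decoded assortment
     has revenue exactly [z]. *)
  have zS : expected_revenue I S = z.
    apply/expected_revenue_eq; rewrite -sumf; apply: eq_bigr => i _.
    by have [] := SE i.
  have vS : output_value s4 = z.
    have w2 : rmem s2 0 0%N = weight0 I by rewrite a2.2.
    rewrite /output_value a4.2 // val3 w2 -zS expected_revenueE.
    congr (_ / (_ + _)); apply: eq_bigr => i _.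
      by have [] := SE i.
    by have [] := SE i.
  split; first by rewrite vS.
  exists S; first by move=> i k; rewrite out ffunE.
  split; last by rewrite zS.
  by move=> i; have [] := SE i.
have [t [s' [ex tT [mx os]]]] := H.
by exists t => //; exists s'.
Qed.

(** The inequality 1 + x <= exp x at x = - ln 2 reads 1 - ln 2 <= 1/2. *)
Lemma ln2_ge_half (R : realType) : 2^-1 <= ln 2 :> R.
Proof.
have h : (2^-1 : R) = expR (- ln 2) by rewrite expRN lnK // posrE.
have := expR_ge1Dx (- ln 2 : R); rewrite -h.
have : (2^-1 : R) + 2^-1 = 1 by field.
lra.
Qed.

Lemma trunc_log_le_ln (R : realType) k :
  (0 < k)%N -> (trunc_log 2 k)%:R <= 2 * ln k%:R :> R.
Proof.
move=> k0; set l := trunc_log 2 k.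
have lk : (2 ^ l <= k)%N by exact: trunc_logP.
have : ln ((2 ^ l)%N%:R : R) <= ln k%:R.
  by rewrite ler_ln ?posrE ?ltr0n ?expn_gt0 // ler_nat.
rewrite natrX lnXn // -(mulr_natl (ln 2)) => h.
have := @ler_wpM2l R l%:R (ler0n _ _) _ _ (ln2_ge_half R).
lra.
Qed.

Theorem mainTheorem2 :
  exists (p : cmd) (K : nat),
    forall (R : realType) (m n : nat) (I : instance R m n) (s : memory R),
      (1 <= m)%N -> (1 <= n)%N -> (2 <= m * n)%N -> input I s ->
      exists t : nat,
        solves_in I p s t /\
        t%:R <= K%:R * ((m * n ^ 2)%N%:R * ln (m * n)%N%:R) :> R.
Proof.
have [K program_solvesK] := program_solves.
(* The factor 28 is 4 * 7: (n + 1)^2 <= 4 n^2, and e + 1 = 2 l + 5 <= 7 l because mn >= 2 makes l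
   positive. The factor 2 is the price of passing from the binary to the natural logarithm. *)
exists assortment_program, (K * 28 * 2)%N => R m n I s m0 n0 mn2 inp.
set l := trunc_log 2 (m * n).
have l0 : (0 < l)%N by rewrite trunc_log_gt0.
have mnl : (m * n < 2 ^ l.+1)%N by exact: trunc_log_ltn.
have n2 : (n + 1 <= 2 * n)%N by lia.
(* The number of lines is at most 4 n^2 m <= 4 (mn)^2, and mn < 2^(l + 1). *)
have Le : (n.+1 * n.+1 * m < 2 ^ (2 * l + 4))%N.
  have h : (2 ^ (2 * l + 4) = 4 * (2 ^ l.+1 * 2 ^ l.+1))%N.
    by rewrite -(expnD 2) -(expnD 2 2); congr (2 ^ _)%N; lia.
  rewrite h; apply: (@leq_ltn_trans (4 * ((m * n) * (m * n)))).
    have -> : (4 * (m * n * (m * n)) = (2 * n) * (2 * n) * (m * m))%N by ring.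
    by apply: leq_mul; [apply: leq_mul; lia|exact: leq_pmulr].
  by rewrite ltn_pmul2l // ltn_mul.
have [t sol tT] := program_solvesK _ _ _ _ _ _ m0 inp Le.
exists t; split=> //.
have tT' : (t <= K * 28 * (m * n ^ 2) * l)%N.
  apply: (leq_trans tT).
  have -> : (K * 28 * (m * n ^ 2) * l = m * (2 * n) * (2 * n) * (7 * l) * K)%N.
    by rewrite -mulnn; ring.
  rewrite leq_mul2r; apply/orP; right; apply: leq_mul; last by lia.
  by apply: leq_mul => //; apply: leq_mul.
have := @trunc_log_le_ln R (m * n) (ltnW mn2); rewrite -/l => lln.
apply: (@le_trans _ _ (K * 28 * (m * n ^ 2) * l)%N%:R); first by rewrite ler_nat.
rewrite (natrM _ _ l) !(natrM _ (K * 28)%N) -!mulrA.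
apply: ler_wpM2l; first exact: ler0n.
rewrite mulrCA; apply: ler_wpM2l; first exact: ler0n.
exact: lln.
Qed.
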